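(* Define a pair of matrices $\mathsf{A}=(A_1,A_2)\in M_3(\mathbb{R})^2$ by \[A_1:=\left(\begin{array}{ccc}0&1&2\\2&0&0\\1&0&0\end{array}\right),\qquad A_2:=\left(\begin{array}{ccc}0&2&1\\1&0&0\\2&0&0\end{array}\right).\] Then $\mathsf{A}$ is irreducible, and for every $s>0$ the unique equilibrium state of $(\mathsf{A},s)$ is ergodic with respect to $\sigma^3$ but not with respect to $\sigma^2$. For every $s>0$, $(\mathsf{A}_2,s)$ has exactly two ergodic equilibrium states, where $\mathsf{A}_2$ denotes the $4$-tuple of all products $A_{i_2}A_{i_1}$ with $i_1,i_2\in\{1,2\}$, and the average of these two equilibrium states is the equilibrium state of $(\mathsf{A},s)$.
   Context: For $N\geq 2$ let $\Sigma_N=\{1,\ldots,N\}^{\mathbb{N}}$ with the product topology, let $\sigma\colon\Sigma_N\to\Sigma_N$ be the shift $\sigma[(x_i)_{i=1}^\infty]=(x_{i+1})_{i=1}^\infty$, and let $\mathcal{M}_\sigma$ be the set of $\sigma$-invariant Borel probability measures on $\Sigma_N$. $M_d(\mathbb{R})$ is the space of real $d\times d$ matrices and $\|\cdot\|$ is the Euclidean (operator) norm. A tuple $\mathsf{A}=(A_1,\ldots,A_N)\in M_d(\mathbb{R})^N$ is irreducible if there is no linear subspace $U$ with $\{0\}\neq U\subsetneq\mathbb{R}^d$ and $A_iU\subseteq U$ for every $i=1,\ldots,N$. For $s>0$ the pressure is \[P(\mathsf{A},s)=\lim_{n\to\infty}\frac1n\log\left(\sum_{i_1,\ldots,i_n=1}^N\|A_{i_n}\cdots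 A_{i_1}\|^s\right)\in[-\infty,+\infty),\] and for $\mu\in\mathcal{M}_\sigma$ the top Lyapunov exponent is \[\Lambda(\mathsf{A},\mu)=\lim_{n\to\infty}\frac1n\int\log\|A_{x_n}\cdots A_{x_1}\|\,d\mu[(x_i)_{i=1}^\infty].\] With $h(\mu)$ denoting metric entropy, one has $P(\mathsf{A},s)=\sup_{\mu\in\mathcal{M}_\sigma}[h(\mu)+s\Lambda(\mathsf{A},\mu)]$, and a measure $\mu\in\mathcal{M}_\sigma$ attaining this supremum is called an equilibrium state of $(\mathsf{A},s)$. It is known (Feng–Käenmäki) that if $\mathsf{A}$ is irreducible with $d \geq 2$ then for every $s>0$ there is a unique equilibrium state of $(\mathsf{A},s)$, and it is ergodic with respect to $\sigma$. For $n\geq1$, $\mathsf{A}_n$ denotes the $N^n$-tuple of all products $A_{i_n}\cdots A_{i_1}$, indexed by the words $(i_1,\ldots,i_n)\in\{1,\ldots,N\}^n$ in lexicographical order (so the tuple $\mathsf{A}_2$ is not to be confused with the matrix $A_2$). Equilibrium states of $(\mathsf{A}_n,s)$ are a priori shift-invariant measures on $\Sigma_{N^n}$; they are identified with $\sigma^n$-invariant Borel probability measures on $\Sigma_N$ via the natural bijection $\Sigma_N\to\Sigma_{N^n}$ which groups a sequence into consecutive words of length $n$. Ergodicity of an equilibrium state of $(\mathsf{A}_n,s)$ means ergodicity with respect to $\sigma^n$. *)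

(* Defs.v *)
From HB Require Import structures.
From mathcomp Require Import all_boot all_order all_algebra.
From mathcomp Require Import all_classical all_reals all_analysis.

Set Implicit Arguments.
Unset Strict Implicit.
Unset Printing Implicit Defensive.
Import Order.TTheory GRing.Theory Num.Theory.
Import numFieldNormedType.Exports.
Local Open Scope classical_set_scope.
Local Open Scope ring_scope.

(* Measurable types are pointed, so alphabets are pointed (i.e. nonempty)
   finite types. *)
#[short(type="alphabetType")]
HB.structure Definition Alphabet := {I of Finite I & isPointed I}.

HB.instance Definition _ (n : nat) := isPointed.Build 'I_n.+1 ord0.
HB.instance Definition _ (n : nat) (I : alphabetType) :=
  Pointed.on (n.-tuple I).

(* The set I^nat with the product of the discrete topologies. *)
Definition full_shift (I : alphabetType) : Type :=
  prod_topology (fun _ : nat => discrete_topology I).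
HB.instance Definition _ (I : alphabetType) := Pointed.on (full_shift I).
HB.instance Definition _ (I : alphabetType) := Nbhs.on (full_shift I).
HB.instance Definition _ (I : alphabetType) := Topological.on (full_shift I).

(* The same set with its Borel sigma-algebra; coordinates are numbered from 0. *)
Definition shift_space (I : alphabetType) : Type :=
  g_sigma_algebraType (@open (full_shift I)).
HB.instance Definition _ (I : alphabetType) := Measurable.on (shift_space I).

Definition left_shift (I : alphabetType) (x : shift_space I) : shift_space I :=
  fun k => x k.+1.

Section measures.
Context d (T : measurableType d) (R : realType).
Implicit Types (mu nu : probability T R) (f : T -> T).

(* A probability is a function on all subsets of T, with unconstrained values
   off the sigma-algebra: equality of measures is tested on measurable sets. *)
Definition same_measure mu nu := forall B, measurable B -> mu B = nu B.

Definition invariant_measure f mu :=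
  forall B, measurable B -> mu (f @^-1` B) = mu B.

(* Meaningful when mu is f-invariant. *)
Definition ergodic f mu :=
  forall B, measurable B -> f @^-1` B = B -> mu B = 0%E \/ mu B = 1%E.

Definition measurable_partition (k : nat) (P : 'I_k -> set T) :=
  [/\ forall i, measurable (P i), \bigcup_i P i = setT & trivIset setT P].

Definition partition_entropy mu (J : finType) (P : J -> set T) : R :=
  - \sum_j fine (mu (P j)) * ln (fine (mu (P j))).

(* The join of P, f^-1 P, ..., f^-(n-1) P, indexed by names. *)
Definition iterated_join f (k : nat) (P : 'I_k -> set T) (n : nat)
    (w : {ffun 'I_n -> 'I_k}) : set T :=
  [set x | forall j : 'I_n, P (w j) (iter j f x)].

Definition metric_entropy_of f mu (k : nat) (P : 'I_k -> set T) : \bar R :=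
  limn (fun n => (n%:R^-1 * partition_entropy mu (iterated_join f P (n := n)))%:E).

Definition metric_entropy f mu : \bar R :=
  ereal_sup [set h | exists (k : nat) (P : 'I_k -> set T),
    measurable_partition P /\ h = metric_entropy_of f mu P].

End measures.

Section matrix_tuples.
Context (R : realType) (d : nat).

Definition euclidean_norm (v : 'cV[R]_d) : R :=
  Num.sqrt (\sum_i v i ord0 ^+ 2).

Definition operator_norm (B : 'M[R]_d) : R :=
  sup [set euclidean_norm (B *m v) | v in [set v | euclidean_norm v <= 1]].

Context (I : alphabetType).
Implicit Types (A : I -> 'M[R]_d).

Definition irreducible_tuple A :=
  forall U : {vspace 'cV[R]_d},
    (forall i v, v \in U -> A i *m v \in U) -> U = 0%VS \/ U = fullv.

(* word_product A [:: i_1; ...; i_n] = A i_n *m ... *m A i_1. *)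
Definition word_product A (w : seq I) : 'M[R]_d :=
  foldl (fun B i => A i *m B) 1%:M w.

(* The tuple of products of length n, indexed by the words themselves. *)
Definition block_tuple A (n : nat) : n.-tuple I -> 'M[R]_d :=
  fun w => word_product A w.

(* lne 0 = -oo, and the integral is extended-real-valued. *)
Definition lyapunov A (mu : probability (shift_space I) R) : \bar R :=
  limn (fun n => ((n%:R^-1)%:E *
    \int[mu]_x lne (operator_norm (word_product A (mkseq x n)))%:E)%E).

Definition free_energy A (s : R) (mu : probability (shift_space I) R) : \bar R :=
  (metric_entropy (@left_shift I) mu + s%:E * lyapunov A mu)%E.

Definition equilibrium_state A (s : R) (mu : probability (shift_space I) R) :=
  invariant_measure (@left_shift I) mu /\
  free_energy A s mu =
    ereal_sup [set free_energy A s nu |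
      nu in [set nu | invariant_measure (@left_shift I) nu]].

End matrix_tuples.

(* The grouping of a sequence into consecutive words of length n; a bijection
   for n > 0. *)
Definition block (I : alphabetType) (n : nat) (x : shift_space I) :
    shift_space (n.-tuple I) :=
  fun k => [tuple x (k * n + j)%N | j < n].

Lemma block_shift (I : alphabetType) (n : nat) (x : shift_space I) :
  block n (iter n (@left_shift I) x) = left_shift (block n x).
Proof.
have iterE m k : iter m (@left_shift I) x k = x (k + m)%N.
  by elim: m k => [|m IH] k /=; rewrite ?addn0// /left_shift IH addSnnS.
apply/funext => k; apply: eq_from_tnth => j.
by rewrite /left_shift /block !tnth_mktuple iterE mulSn addnC addnA.
Qed.

Lemma continuous_to_prod (X : topologicalType) (J : Type)
    (K : J -> topologicalType) (f : X -> prod_topology K) :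
  (forall j, continuous (fun x => f x j)) -> continuous f.
Proof.
move=> fc x.
apply: (iffRL (@cvg_sup (forall j, K j) _ _ _ _ _)).
move=> j.
move=> U [_ [[W oW <-] /= Wfx WU]].
rewrite /nbhs/=.
apply: (filterS (P := (fun x => f x j) @^-1` W)).
  by move=> y Wy; exact: WU.
by apply: fc; exact: open_nbhs_nbhs.
Qed.

Lemma continuous_block (I : alphabetType) (n : nat) :
  continuous (@block I n : full_shift I -> full_shift (n.-tuple I)).
Proof.
have h := @continuous_to_prod (full_shift I) nat
  (fun=> discrete_topology (n.-tuple I)) (@block I n).
apply h => k x U xU.
pose S (j : 'I_n) : set (full_shift I) :=
  [set y | y (k * n + j)%N = x (k * n + j)%N].
have nbS (j : 'I_n) : nbhs x (S j).
  apply: (@proj_continuous nat (fun=> discrete_topology I) (k * n + j)%N x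
    [set x (k * n + j)%N]).
  exact: (@discrete_set1 (discrete_topology I)).
have : nbhs x [set y | forall j, S j y].
  exact: (@filter_forall _ _ S (nbhs x) _ nbS).
apply: filterS => y xy; rewrite /=.
suff -> : block n y k = block n x k.
  exact: (@nbhs_singleton (discrete_topology (n.-tuple I)) _ U xU).
by apply: eq_from_tnth => j; rewrite /block !tnth_mktuple xy.
Qed.

Lemma measurable_block (I : alphabetType) (n : nat) :
  measurable_fun setT (@block I n).
Proof.
apply: (@measurability _ _ (shift_space I) (shift_space (n.-tuple I)) setT
  (@block I n) (@open (full_shift (n.-tuple I)))); first by [].
move=> _ [B oB <-]; apply: sub_sigma_algebra; rewrite setTI.
have /continuousP := @continuous_block I n.
by apply.
Qed.

HB.instance Definition _ (I : alphabetType) (n : nat) :=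
  isMeasurableFun.Build _ _ _ _ (@block I n) (@measurable_block I n).

(* The push-forward of mu by [block] is shift-invariant iff mu is invariant
   under the n-th iterate of [left_shift], cf. [block_shift]. *)
Definition block_equilibrium_state (R : realType) (d : nat) (I : alphabetType)
    (A : I -> 'M[R]_d) (n : nat) (s : R) (mu : probability (shift_space I) R) :=
  equilibrium_state (@block_tuple R d I A n) s (distribution mu (@block I n)).

Definition mx_of_rows (R : realType) (n : nat) (rows : seq (seq R)) : 'M[R]_n :=
  \matrix_(i, j) nth 0 (nth [::] rows i) j.

Definition example_pair (R : realType) (i : 'I_2) : 'M[R]_3 :=
  if i == ord0 then
    mx_of_rows 3 [:: [:: 0; 1; 2];
                     [:: 2; 0; 0];
                     [:: 1; 0; 0]]
  else
    mx_of_rows 3 [:: [:: 0; 2; 1];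
                     [:: 1; 0; 0];
                     [:: 2; 0; 0]].

(* Main.v *)
From HB Require Import structures.
Require Import Defs.
From mathcomp Require Import all_boot all_order all_algebra.
From mathcomp Require Import all_classical all_reals all_analysis.
From mathcomp Require Import measurable_realfun ring lra.

Set Implicit Arguments.
Unset Strict Implicit.
Unset Printing Implicit Defensive.
Import Order.TTheory GRing.Theory Num.Theory.
Import numFieldNormedType.Exports.
Local Open Scope classical_set_scope.
Local Open Scope ring_scope.

(* Set c(a, b) = 4 if a = b and 5 otherwise. Both matrices exchange the line V1
   spanned by the first basis vector with the plane V2 spanned by the others,
   and A_b A_a acts on V1 as c(a, b). Hence the norm of A_(x_n) ... A_(x_1) is,
   up to a bounded factor, the larger of
     c(x_1, x_2) c(x_3, x_4) ...   and   c(x_2, x_3) c(x_4, x_5) ...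
   Let nu1 make the pairs (x_1, x_2), (x_3, x_4), ... independent with law
   proportional to c^s, let nu2 be its image by the shift, mu their average and
   P = ln (2 (4^s + 5^s)) / 2. The norm to the power s is then comparable with
   exp (n P) mu [x_1 ... x_n]. For every invariant nu, Gibbs' inequality bounds
   the free energy by P, and in case of equality it bounds the relative
   entropies of nu with respect to mu on words of all lengths, so that nu is
   absolutely continuous with respect to mu. The measure nu1 is Bernoulli in blocks of
   length 2, hence ergodic for all powers of the square of the shift, and
   invariant Hahn sets show that an invariant measure absolutely continuous with
   respect to an ergodic one equals it and that distinct ergodic measures are
   mutually singular. *)

(** * Entropy of finite-valued random variables *)

(** The coefficients 4 and 5 are products of a row [(1, 2)] or [(2, 1)] of one matrix with a column
    [(2, 1)] or [(1, 2)] of another. Each letter has one partner with coefficient 4 and one with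
    coefficient 5, so single letters are uniform under [nu1], and shifting the pairing by one letter
    only costs a bounded factor; but [4 ^ s] and [5 ^ s] differ, so the two letters of a pair are
    dependent and [nu1] is not shift-invariant. The norm is bounded above in terms of the average
    [mu] only, since either of the two products may be the larger one, whereas it is bounded below
    by [nu1] and by [nu2] separately. This asymmetry is what gives two ergodic equilibrium states to
    the tuple of products of length 2 and a single one to the pair. Metric entropy is a supremum
    over all finite partitions, while the estimates concern words; the Kolmogorov-Sinai theorem
    bridges the two. *)

Definition finite_rv d (T : measurableType d) (J : finType) (X : T -> J) :=
  forall j, measurable (X @^-1` [set j]).

Definition mass d (T : measurableType d) (R : realType) (mu : probability T R)
    (J : finType) (X : T -> J) (j : J) : R :=
  fine (mu (X @^-1` [set j])).

Definition entropy d (T : measurableType d) (R : realType)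
    (mu : probability T R) (J : finType) (X : T -> J) : R :=
  - \sum_j mass mu X j * ln (mass mu X j).

Section finite_random_variables.
Context d (T : measurableType d) (R : realType).
Implicit Types (mu : probability T R) (J K L : finType).

Lemma probability_fineK mu (B : set T) :
  measurable B -> (fine (mu B))%:E = mu B.
Proof. by move=> mB; rewrite fineK// fin_num_measure. Qed.

Lemma finite_rv_preimage J (X : T -> J) (S : set J) :
  finite_rv X -> measurable (X @^-1` S).
Proof.
move=> mX; rewrite (_ : X @^-1` S = \bigcup_(j in S) X @^-1` [set j]).
  by apply: fin_bigcup_measurable => // j _; exact: mX.
by apply/seteqP; split=> [x Sx|x [j Sj /= ->]//]; exists (X x).
Qed.

Lemma finite_rv_comp J K (X : T -> J) (h : J -> K) :
  finite_rv X -> finite_rv (h \o X).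
Proof. by move=> mX k; exact: (finite_rv_preimage (h @^-1` [set k])). Qed.

Lemma finite_rv_pair J K (X : T -> J) (Y : T -> K) :
  finite_rv X -> finite_rv Y -> finite_rv (fun x => (X x, Y x)).
Proof.
move=> mX mY [j k]; rewrite (_ : _ @^-1` _ =
  X @^-1` [set j] `&` Y @^-1` [set k]); first exact: measurableI.
by apply/seteqP; split=> [x [<- <-]|x [/= -> ->]].
Qed.

Lemma probability_finite_rv mu J (X : T -> J) (S : pred J) : finite_rv X ->
  fine (mu [set x | S (X x)]) = \sum_(j | S j) mass mu X j.
Proof.
move=> mX; pose r := [seq j <- index_enum J | S j].
have -> : [set x | S (X x)] = \bigcup_(j in [set` r]) X @^-1` [set j].
  apply/seteqP; split=> [x Sx|x [j /=]].
    by exists (X x) => //=; rewrite mem_filter mem_index_enum andbT.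
  by rewrite mem_filter => /andP[Sj _] ->.
rewrite measure_fin_bigcup//.
- rewrite -fsbig_seq ?filter_uniq ?index_enum_uniq// big_filter sum_fine//.
  by move=> j _; exact: fin_num_measure.
- by move=> i j _ _ [x [/= <- <-]].
Qed.

Lemma mass_ge0 mu J (X : T -> J) j : 0 <= mass mu X j.
Proof. by rewrite fine_ge0. Qed.

Lemma sum_mass mu J (X : T -> J) : finite_rv X -> \sum_j mass mu X j = 1.
Proof.
move=> mX; rewrite -(probability_finite_rv mu predT mX).
rewrite (_ : [set x | _] = setT) ?probability_setT//.
by apply/seteqP; split.
Qed.

Lemma mass_le1 mu J (X : T -> J) j : finite_rv X -> mass mu X j <= 1.
Proof.
by move=> mX; rewrite -lee_fin probability_fineK// probability_le1.
Qed.

Lemma mass_comp mu J K (X : T -> J) (h : J -> K) k : finite_rv X ->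
  mass mu (h \o X) k = \sum_(j | h j == k) mass mu X j.
Proof.
move=> mX; rewrite -probability_finite_rv// /mass; congr (fine (mu _)).
by apply/seteqP; split=> x /= /eqP.
Qed.

Lemma expectation_comp mu J K (X : T -> J) (h : J -> K) (phi : K -> R) :
  finite_rv X ->
  \sum_k mass mu (h \o X) k * phi k = \sum_j mass mu X j * phi (h j).
Proof.
move=> mX; rewrite [RHS](partition_big h predT)//=.
apply: eq_bigr => k _; rewrite mass_comp// mulr_suml.
by apply: eq_bigr => j /eqP ->.
Qed.

Lemma mass_le_comp mu J K (X : T -> J) (h : J -> K) j : finite_rv X ->
  mass mu X j <= mass mu (h \o X) (h j).
Proof.
move=> mX; rewrite mass_comp// (bigD1 j)//= lerDl.
by apply: sumr_ge0 => i _; exact: mass_ge0.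
Qed.

Lemma expectation_const mu J (X : T -> J) (c : R) : finite_rv X ->
  \sum_j mass mu X j * c = c.
Proof. by move=> mX; rewrite -mulr_suml sum_mass// mul1r. Qed.

(** Termwise this is [ln t <= t - 1] at [t = q j / mass mu X j]. Only [\sum_j q j <= 1] is required
    because the comparison weights used below may have total mass less than 1. *)
Lemma gibbs_inequality mu J (X : T -> J) (q : J -> R) : finite_rv X ->
  (forall j, 0 <= q j) -> \sum_j q j <= 1 ->
  (forall j, q j = 0 -> mass mu X j = 0) ->
  entropy mu X <= - \sum_j mass mu X j * ln (q j).
Proof.
move=> mX q0 q1 qX; rewrite lerN2 -subr_le0 -sumrB.
apply: (@le_trans _ _ (\sum_j (q j - mass mu X j))); last first.
  by rewrite sumrB sum_mass// subr_le0.
apply: ler_sum => j _.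
have [pj0|pj0] := eqVneq (mass mu X j) 0.
  by rewrite pj0 !mul0r !subr0.
have ppos : 0 < mass mu X j by rewrite lt_neqAle eq_sym pj0 mass_ge0.
have qpos : 0 < q j.
  by rewrite lt_neqAle q0 andbT; apply: contra_neq pj0 => /esym /qX.
rewrite -mulrBr -ln_div// -ler_pdivlMl//.
have -> : (mass mu X j)^-1 * (q j - mass mu X j) = q j / mass mu X j - 1.
  by rewrite mulrBr mulVf// mulrC.
have := @le_ln1Dx R (q j / mass mu X j - 1); rewrite [1 + _]addrC subrK; apply.
by rewrite ltrBrDl subrr divr_gt0.
Qed.

Lemma entropy_ge0 mu J (X : T -> J) : finite_rv X -> 0 <= entropy mu X.
Proof.
move=> mX; rewrite oppr_ge0; apply: sumr_le0 => j _.
by rewrite mulr_ge0_le0 ?mass_ge0// ln_le0// mass_le1.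
Qed.

Lemma entropy_comp_le mu J K (X : T -> J) (h : J -> K) : finite_rv X ->
  entropy mu (h \o X) <= entropy mu X.
Proof.
move=> mX; rewrite lerN2 (expectation_comp mu h (fun k =>
  ln (mass mu (h \o X) k)))//.
apply: ler_sum => j _; have [->|pj0] := eqVneq (mass mu X j) 0.
  by rewrite !mul0r.
have ppos : 0 < mass mu X j by rewrite lt_neqAle eq_sym pj0 mass_ge0.
rewrite ler_wpM2l ?mass_ge0// ler_ln ?posrE//.
- exact: mass_le_comp.
- by apply: lt_le_trans ppos _; exact: mass_le_comp.
Qed.

Lemma entropy_inj mu J K (X : T -> J) (h : J -> K) (g : K -> J) :
  finite_rv X -> cancel h g -> entropy mu (h \o X) = entropy mu X.
Proof.
move=> mX hK; apply/eqP; rewrite eq_le entropy_comp_le//=.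
have {1}-> : X = g \o (h \o X) by apply/funext => x /=; rewrite hK.
by rewrite entropy_comp_le//; exact: finite_rv_comp.
Qed.

(** Gibbs' inequality against the product of the two marginals, restricted to the pairs
    [(a z, b z)]. *)
Lemma entropy_pair_le mu J K L (Z : T -> L) (a : L -> J) (b : L -> K) :
  finite_rv Z -> injective (fun z => (a z, b z)) ->
  entropy mu Z <= entropy mu (a \o Z) + entropy mu (b \o Z).
Proof.
move=> mZ inj.
apply: le_trans (@gibbs_inequality mu L Z
  (fun z => mass mu (a \o Z) (a z) * mass mu (b \o Z) (b z)) mZ _ _ _) _.
- by move=> z; rewrite mulr_ge0// mass_ge0.
- pose F := fun jk : J * K => mass mu (a \o Z) jk.1 * mass mu (b \o Z) jk.2.
  have -> : 1 = \sum_jk F jk.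
    rewrite -(pair_big predT predT (fun j k => F (j, k)))/=.
    rewrite -(sum_mass mu (finite_rv_comp a mZ)); apply: eq_bigr => j _.
    by rewrite /F/= -mulr_sumr sum_mass ?mulr1//; exact: finite_rv_comp.
  (* By injectivity the sum over [z] runs over distinct pairs, so it is a partial sum of the total
     mass 1 of the product law. *)
  pose s := [seq (a z, b z) | z <- enum L].
  have -> : \sum_z mass mu (a \o Z) (a z) * mass mu (b \o Z) (b z) =
      \sum_(jk <- s) F jk by rewrite big_map big_enum.
  rewrite big_uniq/=; last by rewrite map_inj_uniq ?enum_uniq.
  rewrite [leRHS](bigID (mem s))/= lerDl sumr_ge0// => jk _.
  by rewrite mulr_ge0 ?mass_ge0.
- move=> z /eqP; rewrite mulf_eq0 => /orP[] /eqP p0; apply/eqP;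
  rewrite eq_le mass_ge0 andbT -p0; exact: mass_le_comp.
rewrite -opprD lerN2.
rewrite (expectation_comp mu a (fun k => ln (mass mu (a \o Z) k)))//.
rewrite (expectation_comp mu b (fun k => ln (mass mu (b \o Z) k)))//.
rewrite -big_split/=; apply: ler_sum => z _; rewrite -mulrDr.
have [->|pj0] := eqVneq (mass mu Z z) 0; first by rewrite !mul0r.
have ppos : 0 < mass mu Z z by rewrite lt_neqAle eq_sym pj0 mass_ge0.
by rewrite lnM// posrE (lt_le_trans ppos)// mass_le_comp.
Qed.

End finite_random_variables.

(** * Subadditivity and entropy rates *)

(** The limit is the infimum of [u n / n]; this gives the second conclusion, a bound at every finite
    length, which the limit alone would not provide. *)
Lemma fekete (R : realType) (u : nat -> R) :
  (forall m n, u (m + n)%N <= u m + u n) -> (forall n, 0 <= u n) ->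
  exists l : R, (fun n => n%:R^-1 * u n) @ \oo --> l /\
    forall n, n%:R * l <= u n.
Proof.
move=> uD u0; pose S := [set n%:R^-1 * u n | n in [set n | (0 < n)%N]].
have lbS : lbound S 0 by move=> _ [n _ <-]; rewrite mulr_ge0// invr_ge0.
have infS : has_inf S by split; [exists (1^-1 * u 1), 1%N|exists 0].
have inf_le n : (0 < n)%N -> inf S <= n%:R^-1 * u n.
  by move=> n0; apply: ge_inf; [exists 0|exists n].
exists (inf S); split; last first.
  case=> [|n]; first by rewrite mul0r.
  by rewrite -ler_pdivlMl ?ltr0n// inf_le.
apply/cvgrPdist_lt => e e0.
have e20 : 0 < e / 2 by rewrite divr_gt0.
have [_ [n n0 <-] un] := inf_adherent e20 infS.
have uMn q r : u (q * n + r)%N <= q%:R * u n + u r.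
  elim: q => [|q IH]; first by rewrite mul0n add0n mul0r add0r.
  rewrite mulSn -addnA (le_trans (uD _ _))// (le_trans (lerD (lexx _) IH))//.
  by rewrite addrA -{1}[u n]mul1r -mulrDl -natr1 [q%:R + 1]addrC.
pose M := \sum_(r < n) u r.
have uM r : (r < n)%N -> u r <= M.
  move=> rn; rewrite /M (bigD1 (Ordinal rn))//= lerDl.
  by apply: sumr_ge0.
have M0 : 0 <= M / (e / 2) by rewrite divr_ge0// ?sumr_ge0// ltW.
near=> k.
have kM : M / (e / 2) < k%:R.
  apply: lt_le_trans (archi_boundP M0) _; rewrite ler_nat.
  by near: k; exact: nbhs_infty_ge.
have k0 : (0 < k)%N by rewrite -(ltr0n R); exact: le_lt_trans M0 kM.
rewrite distrC ger0_norm ?subr_ge0 ?inf_le// ltrBlDl.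
(* Divide [k] by [n]: the quotient contributes at most [u n / n], and the remainder at most [M / k],
   which is below [e / 2] by the choice of [k]. *)
rewrite [e]splitr addrA; apply: le_lt_trans (_ : _ <= n%:R^-1 * u n + k%:R^-1
  * M) _.
  rewrite -(ler_pM2l (_ : 0 < k%:R)) ?ltr0n// mulVKf ?pnatr_eq0 -?lt0n//.
  rewrite mulrDr mulVKf ?pnatr_eq0 -?lt0n//.
  rewrite {1}(divn_eq k n) (le_trans (uMn _ _))// lerD ?uM ?ltn_mod//.
  rewrite mulrA ler_wpM2r// ler_pdivlMr ?ltr0n// -natrM ler_nat.
  exact: leq_trunc_div.
by rewrite ltrD// mulrC ltr_pdivrMr ?ltr0n// mulrC -ltr_pdivrMr.
Unshelve. all: by end_near.
Qed.

Definition itinerary (T : Type) (J : finType) (f : T -> T) (X : T -> J)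
    (n : nat) (x : T) : {ffun 'I_n -> J} :=
  [ffun i : 'I_n => X (iter i f x)].

Section stationary_processes.
Context d (T : measurableType d) (R : realType) (mu : probability T R).
Context (f : T -> T).
Hypotheses (mf : measurable_fun setT f) (finv : invariant_measure f mu).

Lemma measurable_iter_preimage n (B : set T) :
  measurable B -> measurable (iter n f @^-1` B).
Proof.
move=> mB; elim: n => [//|n mfB].
rewrite (_ : _ @^-1` _ = f @^-1` (iter n f @^-1` B)).
  by rewrite -[X in measurable X]setTI; exact: mf.
by apply/seteqP; split=> x /=; rewrite -iterSr.
Qed.

Lemma measurable_iter n : measurable_fun setT (iter n f).
Proof.
move=> _ B mB; rewrite setTI; exact: measurable_iter_preimage.
Qed.

Lemma invariant_iter n : invariant_measure (iter n f) mu.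
Proof.
move=> B mB; elim: n => [//|n IH].
rewrite (_ : _ @^-1` _ = f @^-1` (iter n f @^-1` B)).
  by rewrite finv//; exact: measurable_iter_preimage.
by apply/seteqP; split=> x /=; rewrite -iterSr.
Qed.

Lemma finite_rv_iter (J : finType) (X : T -> J) n :
  finite_rv X -> finite_rv (X \o iter n f).
Proof. by move=> mX j; exact: (measurable_iter_preimage n (mX j)). Qed.

Lemma mass_iter (J : finType) (X : T -> J) n j :
  finite_rv X -> mass mu (X \o iter n f) j = mass mu X j.
Proof.
by move=> mX; rewrite /mass comp_preimage (invariant_iter n (mX j)).
Qed.

Lemma entropy_iter (J : finType) (X : T -> J) n :
  finite_rv X -> entropy mu (X \o iter n f) = entropy mu X.
Proof.
by move=> mX; congr (- _); apply: eq_bigr => j _; rewrite mass_iter.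
Qed.

Lemma finite_rv_itinerary (J : finType) (X : T -> J) n :
  finite_rv X -> finite_rv (itinerary f X n).
Proof.
move=> mX w; rewrite (_ : _ @^-1` _ =
    \bigcap_(i in [set: 'I_n]) (X \o iter i f) @^-1` [set w i]).
  by apply: fin_bigcap_measurable => // i _; exact: finite_rv_iter.
apply/seteqP; split=> [x <- i _ /=|x wx]; first by rewrite ffunE.
by apply/ffunP => i; rewrite ffunE; exact: wx.
Qed.

Lemma entropy_itinerary_subadditive (J : finType) (X : T -> J) n m :
  finite_rv X -> entropy mu (itinerary f X (n + m)) <=
  entropy mu (itinerary f X n) + entropy mu (itinerary f X m).
Proof.
move=> mX.
pose a (w : {ffun 'I_(n + m) -> J}) := [ffun i : 'I_n => w (lshift m i)].
pose b (w : {ffun 'I_(n + m) -> J}) := [ffun i : 'I_m => w (rshift n i)].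
have ea : itinerary f X n = a \o itinerary f X (n + m).
  by apply/funext => x; apply/ffunP => i; rewrite !ffunE.
have eb : itinerary f X m \o iter n f = b \o itinerary f X (n + m).
  apply/funext => x; apply/ffunP => i; rewrite !ffunE/=.
  by rewrite addnC iterD.
rewrite -(entropy_iter n (finite_rv_itinerary (n := m) mX)) ea eb.
apply: entropy_pair_le; first exact: finite_rv_itinerary.
move=> w w' [/ffunP ea' /ffunP eb']; apply/ffunP => i.
by case: (split_ordP i) => j ->; [move: (ea' j)|move: (eb' j)]; rewrite !ffunE.
Qed.

Lemma entropy_rate_exists (J : finType) (X : T -> J) : finite_rv X ->
  exists h : R, (fun n => n%:R^-1 * entropy mu (itinerary f X n)) @ \oo --> h
    /\ forall n, n%:R * h <= entropy mu (itinerary f X n).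
Proof.
move=> mX; apply: (@fekete R (fun n => entropy mu (itinerary f X n))).
  by move=> m n; exact: entropy_itinerary_subadditive.
by move=> n; apply: entropy_ge0; exact: finite_rv_itinerary.
Qed.

Lemma partition_finite_rv k (P : 'I_k -> set T) : measurable_partition P ->
  exists2 X : T -> 'I_k, finite_rv X & P = fun j => X @^-1` [set j].
Proof.
move=> [mP PT tP].
have /choice[X PX] : forall x, exists i, P i x.
  by move=> x; have [i _ Pix] : (\bigcup_i P i) x; [rewrite PT|exists i].
have PE : P = fun j => X @^-1` [set j].
  apply/funext => j; apply/seteqP; split=> x /=; last by move=> <-.
  by move=> Pjx; apply: tP => //; exists x.
by exists X => // j; rewrite /= -[_ @^-1` _]/((fun j => X @^-1` [set j]) j) -PE.
Qed.

Lemma partition_entropy_rv k (X : T -> 'I_k) n :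
  partition_entropy mu (iterated_join f (fun j => X @^-1` [set j]) (n := n)) =
  entropy mu (itinerary f X n).
Proof.
congr (- _); apply: eq_bigr => w _; rewrite /mass.
suff -> : iterated_join f (fun j => X @^-1` [set j]) w =
  itinerary f X n @^-1` [set w] by [].
apply/seteqP; split=> [x wx|x <- i /=]; last by rewrite ffunE.
by apply/ffunP => i; rewrite ffunE; exact: wx.
Qed.

End stationary_processes.

(** * Cylinders of the full shift *)

Definition word (I : alphabetType) (n : nat) (x : shift_space I) : n.-tuple I :=
  [tuple x i | i < n].

Definition cylinder (I : alphabetType) (n : nat) (S : pred (seq I)) :
  set (shift_space I) := [set x | S (mkseq x n)].

Section shift_space.
Context (I : alphabetType).

Lemma val_word n (x : shift_space I) : word n x = mkseq x n :> seq I.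
Proof.
by rewrite /mkseq -val_enum_ord -map_comp.
Qed.

Lemma cylinder_word n (S : pred (seq I)) :
  cylinder n S = [set x | S (word n x)].
Proof. by apply/seteqP; split=> x; rewrite /cylinder /= val_word. Qed.

Lemma iter_left_shift n (x : shift_space I) k :
  iter n (@left_shift I) x k = x (k + n)%N.
Proof.
by elim: n k => [|n IH] k /=; rewrite ?addn0// /left_shift IH addSnnS.
Qed.

Lemma open_cylinder (U : set (full_shift I)) (x : full_shift I) :
  open U -> U x ->
  exists n, forall y : full_shift I, mkseq y n = mkseq x n -> U y.
Proof.
move=> oU Ux.
pose B n : set (full_shift I) := [set y | mkseq y n = mkseq x n].
have BS m n : (m <= n)%N -> B n `<=` B m.
  move=> mn y /= /(congr1 (take m)).
  by rewrite /B/= /mkseq -!map_take take_iota (minn_idPl mn).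
(* The cylinders around [x] generate a filter that converges to [x] coordinate by coordinate, so
   every neighborhood of [x] contains one of them. *)
have FF : Filter (filter_from setT B).
  apply: filter_from_filter; first by exists 0%N.
  move=> i j _ _; exists (maxn i j) => // y By; split.
    by apply: BS By; exact: leq_maxl.
  by apply: BS By; exact: leq_maxr.
have : filter_from setT B --> x.
  apply: (iffRL (@cvg_sup (full_shift I) _ _ _ _ FF)) => j.
  move=> V [_ [[W oW <-] /= Wfx WV]].
  exists j.+1 => // y By; apply: WV => /=.
  rewrite /proj (_ : y j = x j) //.
  have /(congr1 (nth point ^~ j)) := By.
  by rewrite !nth_mkseq.
move=> /(_ U); case; first by exact: open_nbhs_nbhs.
by move=> n _ BU; exists n => y yx; exact: BU.
Qed.

(** The predicate selects the words of length [n] all of whose extensions lie in [U], which makes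
    the union increasing in [n]. *)
Lemma open_bigcup_cylinder (U : set (full_shift I)) : open U ->
  U = \bigcup_n cylinder n
    (fun w => `[< forall y : full_shift I, mkseq y n = w -> U y >]).
Proof.
move=> oU; apply/seteqP; split=> x.
  move=> Ux; have [n nU] := open_cylinder oU Ux.
  by exists n => //; exact/asboolP.
by move=> [n _ /asboolP]; exact.
Qed.

Lemma measurable_to_shift d (T : measurableType d) (f : T -> shift_space I) :
  (forall k, finite_rv (fun x => f x k)) -> measurable_fun setT f.
Proof.
move=> mf.
apply: (@measurability _ _ T (shift_space I) setT f (@open
  (full_shift I))) => //.
move=> _ [U oU <-]; rewrite setTI (open_bigcup_cylinder oU) preimage_bigcup.
apply: bigcupT_measurable => n; move: (fun w : seq I => _) => S.
rewrite cylinder_word.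
have mW : finite_rv (word n \o f).
  move=> w; rewrite (_ : _ @^-1` _ =
      \bigcap_(i in [set: 'I_n]) (fun x => f x i) @^-1` [set tnth w i]).
    by apply: fin_bigcap_measurable => // i _; exact: mf.
  apply/seteqP; split=> [x <- i _ /=|x wx]; first by rewrite tnth_mktuple.
  by apply: eq_from_tnth => i; rewrite tnth_mktuple; exact: wx.
exact: (finite_rv_preimage [set w | S (tval w)] mW).
Qed.

Lemma finite_rv_coord k : finite_rv (fun x : shift_space I => x k).
Proof.
move=> j; apply: sub_sigma_algebra; rewrite -[X in open X]/(@proj nat (fun=>
  discrete_topology I) k @^-1` [set j]).
have pc := @proj_continuous nat (fun=> discrete_topology I) k.
rewrite openE => x xj; apply: (pc x).
by rewrite -xj; exact: (@discrete_set1 (discrete_topology I)).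
Qed.

Lemma finite_rv_word n : finite_rv (@word I n).
Proof.
move=> w; rewrite (_ : _ @^-1` _ =
    \bigcap_(i in [set: 'I_n]) (fun x : shift_space I =>
      x i) @^-1` [set tnth w i]).
  by apply: fin_bigcap_measurable => // i _; exact: finite_rv_coord.
apply/seteqP; split=> [x <- i _ /=|x wx]; first by rewrite tnth_mktuple.
by apply: eq_from_tnth => i; rewrite tnth_mktuple; exact: wx.
Qed.

Lemma measurable_left_shift : measurable_fun setT (@left_shift I).
Proof. by apply: measurable_to_shift => k; exact: finite_rv_coord. Qed.

Lemma measurable_cylinder n (S : pred (seq I)) : measurable (cylinder n S).
Proof.
rewrite cylinder_word.
exact: (finite_rv_preimage [set w | S (tval w)] (@finite_rv_word n)).
Qed.

Lemma cylinder_widen n m (S : pred (seq I)) : (n <= m)%N ->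
  cylinder n S = cylinder m (fun w => S (take n w)).
Proof.
move=> nm; apply/seteqP; split=> x; rewrite /cylinder/=;
by rewrite /mkseq -map_take take_iota (minn_idPl nm).
Qed.

End shift_space.

(** * Approximation of Borel sets by cylinders *)

Section cylinder_approximation.
Context (I : alphabetType) (R : realType).
Implicit Types (mu nu : probability (shift_space I) R).

(** One cylinder serves both measures, so that they can be compared on [B] through it. *)
Definition approximable mu nu (B : set (shift_space I)) :=
  forall e : R, 0 < e -> exists n (S : pred (seq I)),
    (mu (B `+` cylinder n S) < e%:E)%E /\ (nu (B `+` cylinder n S) < e%:E)%E.

Lemma measurable_setY (A B : set (shift_space I)) :
  measurable A -> measurable B -> measurable (A `+` B).
Proof. by move=> mA mB; apply: measurableU; exact: measurableD. Qed.

Lemma approximable_cylinder mu nu n (S : pred (seq I)) :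
  approximable mu nu (cylinder n S).
Proof. by move=> e e0; exists n, S; rewrite setYK !measure0 lte_fin. Qed.

Lemma approximableC mu nu B : approximable mu nu B -> approximable mu nu (~` B).
Proof.
move=> aB e /aB[n [S [muS nuS]]]; exists n, (fun w => ~~ S w).
suff -> : ~` B `+` cylinder n (fun w => ~~ S w) = B `+` cylinder n S by [].
rewrite (_ : cylinder _ _ = ~` cylinder n S).
  by rewrite -setTYC -[X in _ `+` X]setTYC -setYA [B `+` _]setYC -setYA setYA
    setYK set0Y setYC.
by apply/seteqP; split=> x; rewrite /cylinder/= => /negP.
Qed.

Lemma probability_sub_lt2 (mu : probability (shift_space I) R) A B C (e : R) :
  measurable A -> measurable B -> measurable C -> C `<=` A `|` B ->
  (mu A < (e / 2)%:E)%E -> (mu B < (e / 2)%:E)%E -> (mu C < e%:E)%E.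
Proof.
move=> mA mB mC CAB muA muB.
apply: (@le_lt_trans _ _ (mu (A `|` B))).
- by apply: le_measure CAB; rewrite inE//; exact: measurableU.
apply: le_lt_trans (measureU2 _ mA mB) _.
by rewrite [e]splitr EFinD lteD.
Qed.

Lemma approximableU mu nu A B : measurable A -> measurable B ->
  approximable mu nu A -> approximable mu nu B -> approximable mu nu (A `|` B).
Proof.
move=> mA mB aA aB e e0; have e20 : 0 < e / 2 by rewrite divr_gt0.
have [n [S [muS nuS]]] := aA _ e20; have [m [U [muU nuU]]] := aB _ e20.
move: muS nuS muU nuU.
rewrite (cylinder_widen S (leq_maxl n m)) (cylinder_widen U (leq_maxr n m)).
move: (maxn n m) (fun w => S _) (fun w => U _) => {n m S U}k S U muS nuS muU
  nuU.
exists k, (fun w => S w || U w).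
have -> : cylinder k (fun w => S w || U w) = cylinder k S `|` cylinder k U.
  by apply/seteqP; split=> x /orP.
have sub : (A `|` B) `+` (cylinder k S `|` cylinder k U) `<=`
    (A `+` cylinder k S) `|` (B `+` cylinder k U).
  by move=> x; rewrite /setY/=; tauto.
by split; apply: (probability_sub_lt2 _ _ _ sub) => //;
  apply: measurable_setY => //; try apply: measurableU => //;
  exact: measurable_cylinder.
Qed.

Lemma approximable_bigcup mu nu (F : (set (shift_space I))^nat) :
  (forall n, measurable (F n)) -> {homo F : n m / (n <= m)%N >-> n `<=` m} ->
  (forall n, approximable mu nu (F n)) -> approximable mu nu (\bigcup_n F n).
Proof.
move=> mF ndF aF e e0; have e20 : 0 < e / 2 by rewrite divr_gt0.
pose D n := \bigcup_k F k `\` F n.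
have mU : measurable (\bigcup_k F k) by exact: bigcupT_measurable.
have mD n : measurable (D n) by exact: measurableD.
have D0 : \bigcap_n D n = set0.
  by apply/seteqP; split=> // x Dx; have [[n _ Fnx] _] := Dx 0%N Logic.I;
    have [_] := Dx n Logic.I.
have small (rho : probability (shift_space I) R) :
    \forall n \near \oo, (rho (D n) < (e / 2)%:E)%E.
  have : rho \o D @ \oo --> rho (\bigcap_n D n).
    apply: nonincreasing_cvg_mu => //.
    - exact: le_lt_trans (probability_le1 rho (mD 0%N)) (ltry 1).
    - by rewrite D0.
    - by move=> n m nm; apply/subsetPset => x [Ux Fx]; split=> // /(ndF _ _ nm).
  rewrite D0 measure0 => /fine_cvgP[_ /cvgrPdist_lt /(_ _ e20)].
  apply: filterS => n /=; rewrite sub0r normrN ger0_norm ?fine_ge0//.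
  by rewrite -lte_fin probability_fineK.
near \oo => n.
have [m [S [muS nuS]]] := aF n _ e20.
exists m, S.
have sub : \bigcup_k F k `+` cylinder m S `<=` D n `|` (F n `+` cylinder m S).
  move=> x [[Ux Sx]|[Sx Ux]].
    by have [Fnx|Fnx] := pselect (F n x); [right; left|left].
  by right; right; split=> // Fnx; apply: Ux; exists n.
have mS := @measurable_cylinder I m S.
split; apply: (probability_sub_lt2 _ _ _ sub) => //; try exact: measurable_setY.
- by near: n; exact: small.
- by near: n; exact: small.
Unshelve. all: by end_near.
Qed.

(** The measurable approximable sets form a sigma-algebra, which contains the open sets since these
    are increasing unions of cylinders. *)
Lemma measurable_approximable mu nu B : measurable B -> approximable mu nu B.
Proof.
move=> mB; pose G := [set B | measurable B /\ approximable mu nu B].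
suff: <<s @open (full_shift I) >> `<=` G by move=> /(_ B mB)[].
apply: smallest_sub; last first.
  move=> U oU; split; first exact: sub_sigma_algebra.
  rewrite (open_bigcup_cylinder oU).
  set S := (S in \bigcup_n cylinder n (S n)).
  apply: approximable_bigcup => [n|n m nm|n]; first exact: measurable_cylinder.
  - move=> x /asboolP Sx; apply/asboolP => y yx; apply: Sx.
    by move: yx => /(congr1 (take n)); rewrite /mkseq -!map_take take_iota
      (minn_idPl nm).
  - exact: approximable_cylinder.
split.
- split; first exact: measurable0.
  suff -> : set0 = cylinder 0 (fun w : seq I =>
    false) by exact: approximable_cylinder.
  by apply/seteqP; split.
- move=> A [mA aA]; rewrite setTD; split; first exact: measurableC.
  exact: approximableC.
move=> A GA; split; first by apply: bigcupT_measurable => n; case: (GA n).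
(* Partial unions turn the countable union into an increasing one, as [approximable_bigcup]
   requires. *)
have GU n : G (\big[setU/set0]_(i < n) A i).
  elim: n => [|n [mU aU]].
    rewrite big_ord0; split; first exact: measurable0.
    suff -> : set0 = cylinder 0 (fun w : seq I =>
      false) by exact: approximable_cylinder.
    by apply/seteqP; split.
  have [mA aA] := GA n; rewrite big_ord_recr/=; split; first exact: measurableU.
  exact: approximableU.
rewrite -(bigcup_bigsetU_bigcup A); apply: approximable_bigcup.
- by move=> n; case: (GU n.+1).
- by move=> n m nm; exact: subset_bigsetU.
- by move=> n; case: (GU n.+1).
Qed.

Lemma probability_dist_setY (mu : probability (shift_space I) R) A B :
  measurable A -> measurable B ->
  `|fine (mu A) - fine (mu B)| <= fine (mu (A `+` B)).
Proof.
have le C D : measurable C -> measurable D ->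
    fine (mu C) <= fine (mu D) + fine (mu (C `+` D)).
  move=> mC mD; have mY := measurable_setY mC mD.
  rewrite -lee_fin EFinD !probability_fineK//.
  apply: le_trans (measureU2 _ mD mY); apply: le_measure; rewrite ?inE//.
    exact: measurableU.
  by move=> x Cx; have [Dx|Dx] := pselect (D x); [left|right; left].
move=> mA mB; rewrite ler_norml lerBlDl lerNl opprB lerBlDl le//= setYC andbT.
exact: le.
Qed.

Lemma same_measure_words mu nu :
  (forall n w, mass mu (@word I n) w = mass nu (@word I n) w) ->
  same_measure mu nu.
Proof.
move=> eqw B mB.
rewrite -(probability_fineK mu mB) -(probability_fineK nu mB); congr (_%:E).
apply/eqP; rewrite -subr_eq0 -normr_le0; apply/ler_addgt0Pl => e e0.
have e20 : 0 < e / 2 by rewrite divr_gt0.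
have [n [S [muS nuS]]] := measurable_approximable mu nu mB e20.
have mS := @measurable_cylinder I n S; have mY := measurable_setY mB mS.
have eqS : fine (mu (cylinder n S)) = fine (nu (cylinder n S)).
  rewrite cylinder_word !(probability_finite_rv _ (fun w : n.-tuple I => S w)
    (@finite_rv_word I n)).
  exact: eq_bigr.
rewrite -(probability_fineK mu mY) lte_fin in muS.
rewrite -(probability_fineK nu mY) lte_fin in nuS.
rewrite addr0 -[fine (mu B)](subrK (fine (mu (cylinder n S)))) -addrA.
rewrite (le_trans (ler_normD _ _))// [e]splitr lerD//.
  exact: le_trans (probability_dist_setY mu mB mS) (ltW _).
rewrite eqS distrC.
exact: le_trans (probability_dist_setY nu mB mS) (ltW _).
Qed.

End cylinder_approximation.

(** * The Kolmogorov-Sinai theorem for the full shift *)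

Lemma ln_prod (R : realType) (K : Type) (s : seq K) (F : K -> R) :
  (forall k, 0 < F k) -> ln (\prod_(k <- s) F k) = \sum_(k <- s) ln (F k).
Proof.
move=> F0; elim: s => [|k s IH]; first by rewrite !big_nil ln1.
by rewrite !big_cons lnM ?IH// posrE ?prodr_gt0.
Qed.

Section kolmogorov_sinai.
Context (I : alphabetType) (R : realType).
Context (mu : probability (shift_space I) R).
Hypothesis muinv : invariant_measure (@left_shift I) mu.

Let mls := @measurable_left_shift I.

Lemma entropy_word n :
  entropy mu (@word I n) =
  entropy mu (itinerary (@left_shift I) (fun x => x 0%N) n).
Proof.
pose h (w : n.-tuple I) := [ffun i : 'I_n => tnth w i].
have -> : itinerary (@left_shift I) (fun x => x 0%N) n = h \o @word I n.
  apply/funext => x; apply/ffunP => i; rewrite !ffunE tnth_mktuple.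
  by rewrite iter_left_shift.
rewrite (@entropy_inj _ _ _ _ _ _ _ h (fun f => [tuple f i | i < n]))//.
  exact: finite_rv_word.
by move=> w; apply: eq_from_tnth => i; rewrite tnth_mktuple ffunE.
Qed.

Lemma entropy_word_subadditive n m :
  entropy mu (@word I (n + m)) <=
  entropy mu (@word I n) + entropy mu (@word I m).
Proof.
rewrite !entropy_word.
exact: (entropy_itinerary_subadditive mls muinv n m (finite_rv_coord 0)).
Qed.

(** Each level set of [X] is approximated by a cylinder up to [e / #|J|], and a long enough window
    decides all these cylinders at once. *)
Lemma finite_rv_approximation (J : finType) (X : shift_space I -> J) (e : R) :
  finite_rv X -> 0 < e -> exists m (g : seq I -> J),
    fine (mu [set x | g (mkseq x m) != X x]) <= e.
Proof.
move=> mX e0; have j0 := X point.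
have J0 : (0 < #|J|)%N by apply/card_gt0P; exists j0.
have e'0 : 0 < e / #|J|%:R by rewrite divr_gt0// ltr0n.
have /choice[F HF] : forall j, exists p : nat * pred (seq I),
    (mu (X @^-1` [set j] `+` cylinder p.1 p.2) < (e / #|J|%:R)%:E)%E.
  move=> j; have [n [S [muS _]]] := measurable_approximable mu mu (mX j) e'0.
  by exists (n, S).
pose m := \max_j (F j).1; pose S j w := (F j).2 (take (F j).1 w).
(* The guess is any symbol whose cylinder contains the word. If it is wrong at [x], then [x] lies in
   [D j] for the guessed [j], or in [D (X x)] when no cylinder contains [x] and the default is
   returned. *)
exists m, (fun w => odflt j0 [pick j | S j w]).
pose D j := X @^-1` [set j] `+` cylinder (F j).1 (F j).2.
have mD j : measurable (D j).
  by apply: measurable_setY; [exact: mX|exact: measurable_cylinder].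
have DE j (x : shift_space I) : S j (mkseq x m) <-> cylinder (F j).1 (F j).2 x.
  rewrite (cylinder_widen (F j).2 (_ : (F j).1 <= m)%N)//.
  exact: (leq_bigmax (F := fun j => (F j).1)).
pose W := [set x : shift_space I | odflt j0 [pick j | S j (mkseq x m)] != X x].
have WD : W `<=` \big[setU/set0]_(j <- enum J) D j.
  move=> x; rewrite /W/= -bigcup_seq/=; case: pickP => [j Sj /= jX|noS _].
    exists j => /=; first by rewrite mem_enum.
    right; split; first exact/DE.
    by move=> /= Xj; rewrite Xj eqxx in jX.
  exists (X x) => /=; first by rewrite mem_enum.
  by left; split=> // /DE; rewrite noS.
have mW : measurable W.
  rewrite (_ : W = \big[setU/set0]_(j <- enum J)
      (X @^-1` [set j] `&` cylinder m (fun w =>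
        odflt j0 [pick j | S j w] != j))).
    apply: bigsetU_measurable => j _; apply: measurableI; first exact: mX.
    exact: measurable_cylinder.
  rewrite -bigcup_seq; apply/seteqP; split=> x.
    by move=> Wx; exists (X x) => //=; rewrite mem_enum.
  by move=> [j _ [/= <-]].
have sub (s : seq J) : (mu (\big[setU/set0]_(j <- s) D j) <= \sum_(j <- s) mu
  (D j))%E.
  elim: s => [|j s IH]; first by rewrite !big_nil measure0.
  rewrite !big_cons; apply: le_trans (measureU2 _ _ _) _ => //.
    exact: bigsetU_measurable.
  by rewrite leeD2l.
have mDU : measurable (\big[setU/set0]_(j <- enum J) D j) by exact:
  bigsetU_measurable.
rewrite -lee_fin probability_fineK//.
apply: (@le_trans _ _ (mu (\big[setU/set0]_(j <- enum J) D j))).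
  by apply: le_measure; rewrite ?inE.
apply: le_trans (sub _) _; rewrite big_enum/=.
apply: (@le_trans _ _ (\sum_(j in J) (e / #|J|%:R)%:E)%E).
  by apply: lee_sum => j _; exact: ltW (HF j).
by rewrite sumEFin sumr_const lee_fin -[leLHS]mulr_natr divfK// pnatr_eq0 -lt0n.
Qed.

(* Gibbs' inequality for the joint law of the name of length [n] and the word of
   length [n + m], against the law where, given the word, the symbols of the
   name are independent and agree with the guess [g] with probability about
   [1 - dl]. *)
Lemma entropy_itinerary_le (J : finType) (X : shift_space I -> J) n m
    (g : seq I -> J) (dl : R) : finite_rv X -> 0 < dl -> dl < 1 ->
  entropy mu (itinerary (@left_shift I) X n) <= entropy mu (@word I (n + m)) +
    n%:R * (- ln (1 - dl) +
      fine (mu [set x | g (mkseq x m) != X x]) * ln (#|J|%:R / dl)).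
Proof.
move=> mX dl0 dl1; set sh := @left_shift I.
have k0 : 0 < #|J|%:R :> R.
  by rewrite ltr0n; apply/card_gt0P; exists (X point).
have dl1' : 0 < 1 - dl by rewrite subr_gt0.
pose Z x := (itinerary sh X n x, @word I (n + m) x).
have mIt : finite_rv (itinerary sh X n) by exact: finite_rv_itinerary.
have mZ : finite_rv Z by apply: finite_rv_pair => //; exact: finite_rv_word.
(* The error mass [dl] is spread over all of [J], the guessed symbol included, so the weights sum to
   at most 1. *)
pose r (p : J) (s : seq I) : R := if p == g s then 1 - dl else dl / #|J|%:R.
have r0 p s : 0 < r p s by rewrite /r; case: ifP => _ //; rewrite divr_gt0.
have r1 s : \sum_p r p s <= 1.
  rewrite (bigD1 (g s))//= {1}/r eqxx.
  rewrite (eq_bigr (fun=> dl / #|J|%:R)); last by move=> p;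
    rewrite /r => /negPf ->.
  rewrite sumr_const -[leRHS](subrK dl) lerD2l -[leLHS]mulr_natr -mulrA.
  rewrite ler_piMr ?(ltW dl0)// mulrC ler_pdivrMr// mul1r ler_nat.
  exact: max_card.
pose sub (y : (n + m).-tuple I) (i : 'I_n) : m.-tuple I :=
  [tuple nth point y (i + k) | k < m].
pose q (z : {ffun 'I_n -> J} * (n + m).-tuple I) :=
  mass mu (@word I (n + m)) z.2 * \prod_(i < n) r (z.1 i) (sub z.2 i).
pose V x := (X x, @word I m x).
have mV : finite_rv V by apply: finite_rv_pair => //; exact: finite_rv_word.
have prod0 (z : {ffun 'I_n -> J} * (n + m).-tuple I) : 0 < \prod_(i < n) r
  (z.1 i) (sub z.2 i).
  by apply: prodr_gt0 => i _.
apply: le_trans (entropy_comp_le mu fst mZ) _.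
apply: le_trans (gibbs_inequality (q := q) mZ _ _ _) _.
- by move=> z; rewrite mulr_ge0 ?mass_ge0// ltW.
- rewrite -(pair_big predT predT (fun j k => q (j, k)))/= exchange_big/=.
  rewrite -(sum_mass mu (@finite_rv_word I (n + m))); apply: ler_sum => y _.
  rewrite /q/= -mulr_sumr ler_piMr ?mass_ge0//.
  rewrite -(bigA_distr_bigA (fun i p => r p (sub y i))).
  by apply: prodr_ile1 => i _; rewrite r1 andbT sumr_ge0// => p _; exact: ltW.
- move=> z /eqP; rewrite mulf_eq0 (gt_eqF (prod0 z)) orbF => /eqP p0.
  apply/eqP; rewrite eq_le mass_ge0 andbT -p0.
  exact: (mass_le_comp mu snd z mZ).
(* The symbol at place [i] with its window is a shifted copy of [V]; by invariance every [i]
   contributes the same expected cost. *)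
pose a (i : 'I_n) (z : {ffun 'I_n -> J} * (n + m).-tuple I) :=
  (z.1 i, sub z.2 i).
have aZ i : a i \o Z = V \o iter i sh.
  apply/funext => x; rewrite /a /V /Z /=; congr pair; first by rewrite ffunE.
  apply: eq_from_tnth => k; rewrite !tnth_mktuple val_word nth_mkseq;
    last first.
    by rewrite -addnS leq_add// ltnW.
  by rewrite iter_left_shift addnC.
have -> : - (\sum_z mass mu Z z * ln (q z)) = entropy mu (@word I (n + m)) +
    \sum_(i < n) \sum_v mass mu V v * - ln (r v.1 v.2).
  have -> : \sum_(i < n) \sum_v mass mu V v * - ln (r v.1 v.2) =
      \sum_(i < n) \sum_z mass mu Z z * - ln (r (z.1 i) (sub z.2 i)).
    apply: eq_bigr => i _.
    rewrite -(expectation_comp mu (a i) (fun v => - ln (r v.1 v.2)) mZ)/= aZ.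
    by apply: eq_bigr => v _; rewrite mass_iter.
  rewrite exchange_big/=.
  rewrite {1}/entropy (expectation_comp mu snd (fun y =>
    ln (mass mu (@word I (n + m)) y)) mZ).
  rewrite -!sumrN -big_split/=; apply: eq_bigr => z _.
  have [->|pz] := eqVneq (mass mu Z z) 0.
    by rewrite !mul0r oppr0 add0r big1// => i _; rewrite mul0r.
  have pw : 0 < mass mu (@word I (n + m)) z.2.
    apply: lt_le_trans (mass_le_comp mu snd z mZ).
    by rewrite lt_neqAle eq_sym pz mass_ge0.
  rewrite lnM ?posrE// ln_prod// mulrDr opprD -mulr_sumr sumrN mulrN.
  by [].
rewrite lerD2l -[n in n%:R]card_ord -sum1_card natr_sum mulr_suml.
apply: ler_sum => i _; rewrite mul1r.
have -> : fine (mu [set x | g (mkseq x m) != X x]) =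
    \sum_v mass mu V v * (g v.2 != v.1)%:R.
  have -> : [set x | g (mkseq x m) != X x] = [set x |
    (fun v : J * m.-tuple I => g v.2 != v.1) (V x)].
    by apply/seteqP; split=> x; rewrite /= val_word.
  rewrite (probability_finite_rv mu (fun v : J * m.-tuple I =>
    g v.2 != v.1) mV).
  rewrite big_mkcond/=; apply: eq_bigr => v _.
  by case: (_ != _); rewrite ?mulr1 ?mulr0.
rewrite -{1}(expectation_const mu (- ln (1 - dl)) mV) mulr_suml -big_split/=.
apply: ler_sum => v _; rewrite -mulrA -mulrDr ler_wpM2l ?mass_ge0//.
have ln0 : 0 <= - ln (1 - dl) by rewrite oppr_ge0 ln_le0// gerBl ltW.
rewrite /r eq_sym; case: eqVneq => _ /=; first by rewrite mul0r addr0.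
rewrite mul1r -lerBlDr -lnV ?posrE ?divr_gt0// invf_div subrr//.
Qed.

End kolmogorov_sinai.

(** * Norms of matrix products *)

Section operator_norm.
Context (R : realType) (d : nat).
Implicit Types (v : 'cV[R]_d) (A B : 'M[R]_d).

Lemma euclidean_norm_ge0 v : 0 <= euclidean_norm v.
Proof. exact: sqrtr_ge0. Qed.

Lemma norm_le_euclidean v i : `|v i ord0| <= euclidean_norm v.
Proof.
rewrite -sqrtr_sqr ler_wsqrtr// (bigD1 i)//= lerDl.
by apply: sumr_ge0 => j _; exact: sqr_ge0.
Qed.

Lemma euclidean_le_sum v : euclidean_norm v <= \sum_i `|v i ord0|.
Proof.
have s0 : 0 <= \sum_i `|v i ord0| by exact: sumr_ge0.
rewrite -(ger0_norm s0) -sqrtr_sqr ler_wsqrtr// expr2 mulr_suml.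
apply: ler_sum => i _; rewrite -real_normK ?num_real// expr2 ler_wpM2l//.
by rewrite (bigD1 i)//= lerDl sumr_ge0.
Qed.

Lemma euclidean_normZ a v : euclidean_norm (a *: v) = `|a| * euclidean_norm v.
Proof.
rewrite /euclidean_norm -sqrtr_sqr -sqrtrM ?sqr_ge0// mulr_sumr.
by congr Num.sqrt; apply: eq_bigr => i _; rewrite mxE exprMn.
Qed.

Lemma euclidean_norm0_eq v : euclidean_norm v = 0 -> v = 0.
Proof.
move=> v0; apply/matrixP => i j; rewrite ord1 mxE; apply/eqP.
by rewrite -normr_le0 -v0 norm_le_euclidean.
Qed.

Let unit_image A :=
  [set euclidean_norm (A *m v) | v in [set v | euclidean_norm v <= 1]].

Lemma euclidean_norm_mulmx_le A v : euclidean_norm v <= 1 ->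
  euclidean_norm (A *m v) <= \sum_i \sum_j `|A i j|.
Proof.
move=> v1; apply: le_trans (euclidean_le_sum _) _; apply: ler_sum => i _.
rewrite mxE; apply: le_trans (ler_norm_sum _ _ _) _; apply: ler_sum => j _.
by rewrite normrM ler_piMr// (le_trans (norm_le_euclidean _ _)).
Qed.

Let unit_image_neq0 A : unit_image A !=set0.
Proof.
exists (euclidean_norm (A *m 0)), 0 => //=; rewrite /euclidean_norm big1
  ?sqrtr0//.
by move=> i _; rewrite mxE expr0n.
Qed.

Lemma operator_norm_ub A v : euclidean_norm v <= 1 ->
  euclidean_norm (A *m v) <= operator_norm A.
Proof.
move=> v1; apply: ub_le_sup; last by exists v.
exists (\sum_i \sum_j `|A i j|) => _ [w w1 <-]; exact: euclidean_norm_mulmx_le.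
Qed.

Lemma operator_norm_le_sum A : operator_norm A <= \sum_i \sum_j `|A i j|.
Proof.
apply: ge_sup; first exact: unit_image_neq0.
by move=> _ [w w1 <-]; exact: euclidean_norm_mulmx_le.
Qed.

Lemma operator_norm_ge0 A : 0 <= operator_norm A.
Proof.
have [_ [v v1 _]] := unit_image_neq0 A.
exact: le_trans (euclidean_norm_ge0 _) (operator_norm_ub A v1).
Qed.

Lemma norm_entry_le_operator_norm A i j : `|A i j| <= operator_norm A.
Proof.
pose e : 'cV[R]_d := delta_mx j ord0.
have e1 : euclidean_norm e <= 1.
  rewrite /euclidean_norm (bigD1 j)//= mxE !eqxx expr1n big1 ?addr0 ?sqrtr1//.
  by move=> k /negPf kj; rewrite mxE kj expr0n.
apply: le_trans (operator_norm_ub A e1).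
apply: le_trans (norm_le_euclidean _ i); rewrite mxE (bigD1 j)//= big1.
  by rewrite mxE !eqxx mulr1 addr0.
by move=> k /negPf kj; rewrite mxE kj mulr0.
Qed.

Lemma euclidean_norm_mulmx A v :
  euclidean_norm (A *m v) <= operator_norm A * euclidean_norm v.
Proof.
have [v0|v0] := eqVneq (euclidean_norm v) 0.
  rewrite (euclidean_norm0_eq v0) mulmx0 -(scale0r 0) euclidean_normZ normr0
    mul0r.
  by rewrite mulr_ge0 ?operator_norm_ge0 ?euclidean_norm_ge0.
have vp : 0 < euclidean_norm v by rewrite lt_neqAle eq_sym v0
  euclidean_norm_ge0.
rewrite -ler_pdivrMr// mulrC -[_^-1]ger0_norm ?invr_ge0 ?euclidean_norm_ge0//.
rewrite -euclidean_normZ scalemxAr operator_norm_ub// euclidean_normZ.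
by rewrite ger0_norm ?invr_ge0 ?euclidean_norm_ge0// mulVf.
Qed.

Lemma operator_normM A B :
  operator_norm (A *m B) <= operator_norm A * operator_norm B.
Proof.
apply: ge_sup; first exact: unit_image_neq0.
move=> _ [v v1 <-]; rewrite -mulmxA (le_trans (euclidean_norm_mulmx _ _))//.
by rewrite ler_wpM2l ?operator_norm_ge0// operator_norm_ub.
Qed.

End operator_norm.

Lemma word_product_foldl (R : realType) d (I : alphabetType)
  (A : I -> 'M[R]_d) w (B : 'M[R]_d) :
  foldl (fun B i => A i *m B) B w = word_product A w *m B.
Proof.
elim/last_ind: w => [|w i IH]; first by rewrite mul1mx.
by rewrite /word_product !foldl_rcons IH mulmxA.
Qed.

Lemma word_product_cat (R : realType) d (I : alphabetType)
  (A : I -> 'M[R]_d) w w' :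
  word_product A (w ++ w') = word_product A w' *m word_product A w.
Proof. by rewrite {1}/word_product foldl_cat word_product_foldl. Qed.

Lemma invn_cvg0 (R : realType) : (fun n => n%:R^-1 : R) @ \oo --> (0 : R).
Proof.
apply: (iffRL (gtr0_cvgV0 (f := fun n => n%:R : R) _)); last exact: cvgr_idn.
by exists 1%N => // n /= n0; rewrite ltr0n.
Qed.

Lemma invn_mulKn_cvg (R : realType) (a : R) :
  (fun n => n%:R^-1 * (n%:R * a)) @ \oo --> a.
Proof.
apply: cvg_near_cst; exists 1%N => // n /= n0.
by rewrite mulKf// pnatr_eq0 -lt0n.
Qed.

Lemma rate_le (R : realType) (u v : nat -> R) (c l l' : R) :
  (forall n, u n <= v n + c) ->
  (fun n => n%:R^-1 * u n) @ \oo --> l ->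
  (fun n => n%:R^-1 * v n) @ \oo --> l' -> l <= l'.
Proof.
move=> uv ul vl.
have vcl : (fun n => n%:R^-1 * v n + n%:R^-1 * c) @ \oo --> l' + 0 * c.
  by apply: cvgD => //; apply: cvgMl; exact: invn_cvg0.
rewrite mul0r addr0 in vcl.
apply: (ler_cvg_to ul vcl); near=> n.
by rewrite -mulrDr ler_wpM2l// invr_ge0.
Unshelve. all: by end_near.
Qed.

(** * Metric entropy of the shift as the growth rate of word entropies *)

Section metric_entropy_of_shift.
Context (I : alphabetType) (R : realType).
Context (mu : probability (shift_space I) R).
Hypothesis muinv : invariant_measure (@left_shift I) mu.
Let sh := @left_shift I.
Let mls := @measurable_left_shift I.

(** Up to rare errors a window of [m] letters determines [X], so a word of length [n + m] determines
    the name of length [n] at a cost of at most [eta] per symbol; the [m] additional letters carry a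
    bounded entropy, which disappears in the rate. *)
Lemma entropy_rate_le (J : finType) (X : shift_space I -> J) (h k : R) :
  finite_rv X ->
  (fun n => n%:R^-1 * entropy mu (itinerary sh X n)) @ \oo --> k ->
  (fun n => n%:R^-1 * entropy mu (@word I n)) @ \oo --> h -> k <= h.
Proof.
move=> mX Xk Wh; apply/ler_addgt0Pr => eta eta0.
have e20 : 0 < eta / 2 by rewrite divr_gt0.
(* Chosen so that [- ln (1 - dl)] is exactly [eta / 2]. *)
pose dl := 1 - expR (- (eta / 2)).
have dl1 : dl < 1 by rewrite gtrBl expR_gt0.
have dl0 : 0 < dl by rewrite subr_gt0 expR_lt1 oppr_lt0.
have lnd : - ln (1 - dl) = eta / 2 by rewrite opprB addrC subrK expRK opprK.
have J0 : (0 < #|J|)%N by apply/card_gt0P; exists (X point).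
have lnJ : 0 <= ln (#|J|%:R / dl).
  rewrite ln_ge0// ler_pdivlMr// mul1r (le_trans (ltW dl1))//.
  by rewrite -[1]/(1%:R) ler_nat.
(* An error probability this small keeps the cost of wrong guesses below the other [eta / 2]; the
   added 1 makes the denominator positive. *)
have e'0 : 0 < eta / 2 / (1 + ln (#|J|%:R / dl)).
  by rewrite divr_gt0// ltr_pwDl.
have [m [g gX]] := finite_rv_approximation mu mX e'0.
apply: (@rate_le _ _ (fun n => entropy mu (@word I n) + n%:R * eta)
  (entropy mu (@word I m)) _ _ _ Xk).
  move=> n; apply: le_trans (entropy_itinerary_le muinv n m g mX dl0 dl1) _.
  rewrite addrAC lerD ?entropy_word_subadditive// ler_wpM2l// lnd.
  rewrite [leRHS]splitr lerD2l.
  apply: le_trans (ler_wpM2r lnJ gX) _.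
  move: lnJ e20; move: (ln _) (eta / 2) => c b c0 b0.
  by rewrite mulrAC ler_pdivrMr ?ltr_pwDl// ler_wpM2l ?(ltW b0)// lerDr.
rewrite (_ : (fun n => _) = fun n =>
    n%:R^-1 * entropy mu (@word I n) + n%:R^-1 * (n%:R * eta)).
  by apply: cvgD => //; exact: invn_mulKn_cvg.
by apply/funext => n; rewrite mulrDr.
Qed.

Lemma finite_rv_partition k (X : shift_space I -> 'I_k) : finite_rv X ->
  measurable_partition (fun j => X @^-1` [set j]).
Proof.
move=> mX; split=> //.
- by apply/seteqP; split=> // x _; exists (X x).
- by move=> i j _ _ [x [/= <- <-]].
Qed.

Lemma metric_entropy_ofE k (X : shift_space I -> 'I_k) (h : R) : finite_rv X ->
  (fun n => n%:R^-1 * entropy mu (itinerary sh X n)) @ \oo --> h ->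
  metric_entropy_of sh mu (fun j => X @^-1` [set j]) = h%:E.
Proof.
move=> mX Xh; apply: cvg_lim => //.
rewrite (_ : (fun n => _) =
    (fun n => (n%:R^-1 * entropy mu (itinerary sh X n))%:E)).
  by apply: cvg_EFin; [exact: nearW|].
by apply/funext => n; rewrite partition_entropy_rv.
Qed.

(** The Kolmogorov-Sinai theorem for the generating partition by the first coordinate: no partition
    exceeds its rate by [entropy_rate_le], and it is itself one of the partitions, after numbering
    the letters. *)
Lemma metric_entropy_word (h : R) :
  (fun n => n%:R^-1 * entropy mu (@word I n)) @ \oo --> h ->
  metric_entropy sh mu = h%:E.
Proof.
move=> Wh; apply/eqP; rewrite eq_le; apply/andP; split.
  apply: ge_ereal_sup => _ [k [P [pP ->]]].
  have [X mX ->] := partition_finite_rv pP.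
  have [hX [Xh _]] := entropy_rate_exists mls muinv mX.
  by rewrite (metric_entropy_ofE mX Xh) lee_fin; exact: entropy_rate_le Xh Wh.
apply: ereal_sup_ubound.
pose X (x : shift_space I) : 'I_#|I| := enum_rank (x 0%N).
have mX : finite_rv X by apply: finite_rv_comp; exact: finite_rv_coord.
exists #|I|, (fun j => X @^-1` [set j]); split;
  first exact: finite_rv_partition.
apply/esym/metric_entropy_ofE => //.
rewrite (_ : (fun n => _) = (fun n => n%:R^-1 * entropy mu (@word I n)))//.
apply/funext => n; congr (_ * _); rewrite entropy_word//.
pose h' (w : {ffun 'I_n -> I}) := [ffun i => enum_rank (w i)].
have -> : itinerary sh X n = h' \o itinerary sh (fun x => x 0%N) n.
  by apply/funext => x; apply/ffunP => i; rewrite !ffunE.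
apply: (@entropy_inj _ _ _ _ _ _ _ h' (fun w => [ffun i => enum_val (w i)])).
  exact: (finite_rv_itinerary mls (finite_rv_coord 0)).
by move=> w; apply/ffunP => i; rewrite !ffunE enum_rankK.
Qed.

End metric_entropy_of_shift.

(** * Free energy and Gibbs measures *)

Lemma integral_finite_rv d (T : measurableType d) (R : realType)
    (mu : probability T R) (J : finType) (X : T -> J) (phi : J -> R) :
  finite_rv X -> (forall j, 0 <= phi j) ->
  (\int[mu]_x (phi (X x))%:E = (\sum_j mass mu X j * phi j)%:E)%E.
Proof.
move=> mX phi0.
have mI j : measurable_fun setT (\1_(X @^-1` [set j]) : T -> R).
  by apply: measurable_indic; exact: mX.
transitivity (\int[mu]_x (\sum_j ((phi j)%:E * (\1_(X @^-1` [set j]) x)%:E)))%E.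
  apply: eq_integral => x _; rewrite (bigD1 (X x))//= indicE mem_set//= mule1.
  rewrite big1 ?adde0// => j jX; rewrite indicE memNset ?mule0//= => Xj.
  by rewrite Xj eqxx in jX.
rewrite ge0_integral_sum//=.
- rewrite -sumEFin; apply: eq_bigr => j _.
  rewrite ge0_integralZl_EFin//; last exact/measurable_EFinP.
  by rewrite integral_indic// setIT EFinM muleC probability_fineK.
- by move=> j; apply: measurable_funeM; exact/measurable_EFinP.
- by move=> j x _; rewrite mule_ge0 ?lee_fin// indicE.
Qed.

Definition mean_log_norm (R : realType) d (I : alphabetType)
    (A : I -> 'M[R]_d) (mu : probability (shift_space I) R) n : R :=
  \sum_w mass mu (@word I n) w * ln (operator_norm (word_product A w)).

Section free_energy.
Context (R : realType) (d : nat) (I : alphabetType) (A : I -> 'M[R]_d) (s : R).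
Hypotheses (A1 : forall w, 1 <= operator_norm (word_product A w)) (s0 : 0 < s).

Let mls := @measurable_left_shift I.

Let A0 w : 0 < operator_norm (word_product A w).
Proof. exact: lt_le_trans ltr01 (A1 w). Qed.

(** Norms at least 1 make the logarithms real and nonnegative, so the extended-valued integral is a
    finite sum. *)
Lemma lyapunov_integral (mu : probability (shift_space I) R) n :
  (\int[mu]_x lne (operator_norm (word_product A (mkseq x n)))%:E)%E =
  (mean_log_norm A mu n)%:E.
Proof.
rewrite -(@integral_finite_rv _ _ _ mu _ (@word I n)
  (fun w : n.-tuple I => ln (operator_norm (word_product A w))))//.
- by apply: eq_integral => x _; rewrite lne_EFin// val_word.
- exact: finite_rv_word.
- by move=> w; exact: ln_ge0.
Qed.

Section invariant.
Context (mu : probability (shift_space I) R).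
Hypothesis muinv : invariant_measure (@left_shift I) mu.

Lemma mean_log_norm_subadditive m n :
  mean_log_norm A mu (m + n) <= mean_log_norm A mu m + mean_log_norm A mu n.
Proof.
pose a (w : (m + n).-tuple I) : m.-tuple I := [tuple nth point w i | i < m].
pose b (w : (m + n).-tuple I) : n.-tuple I :=
  [tuple nth point w (m + i) | i < n].
have wab (w : (m + n).-tuple I) : w = a w ++ b w :> seq I.
  apply: (@eq_from_nth _ point); first by rewrite size_cat !size_tuple.
  move=> i; rewrite size_tuple => imn; rewrite nth_cat size_tuple.
  case: ltnP => im; first by rewrite -[i]/(val
    (Ordinal im)) -tnth_nth tnth_mktuple.
  have inm : (i - m < n)%N by rewrite ltn_subLR.
  by rewrite -[(i - m)%N]/(val (Ordinal inm)) -tnth_nth tnth_mktuple /= subnKC.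
have aW : a \o @word I (m + n) = @word I m.
  apply/funext => x; apply: eq_from_tnth => i; rewrite !tnth_mktuple val_word.
  by rewrite nth_mkseq// ltn_addr.
have bW : b \o @word I (m + n) = @word I n \o iter m (@left_shift I).
  apply/funext => x; apply: eq_from_tnth => i; rewrite !tnth_mktuple val_word.
  by rewrite nth_mkseq ?ltn_add2l// iter_left_shift addnC.
have mW := @finite_rv_word I (m + n).
rewrite /mean_log_norm -{1}aW (expectation_comp _ _ _ mW).
have <- : \sum_w mass mu (b \o @word I (m + n)) w *
    ln (operator_norm (word_product A w)) =
  \sum_w mass mu (@word I n) w * ln (operator_norm (word_product A w)).
  apply: eq_bigr => w _; rewrite bW mass_iter//; exact: finite_rv_word.
rewrite (expectation_comp _ _ _ mW) -big_split/=.
apply: ler_sum => w _; rewrite -mulrDr ler_wpM2l ?mass_ge0//.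
rewrite -lnM ?posrE// {1}wab word_product_cat mulrC ler_ln ?posrE//.
- exact: operator_normM.
- by rewrite -word_product_cat.
- exact: mulr_gt0.
Qed.

(** The last clause holds at each length with no error term; this exactness lets [cylinder_le_gibbs]
    bound relative entropies by a constant independent of [n]. *)
Lemma free_energy_limit : exists2 F : R, free_energy A s mu = F%:E &
  (fun n => n%:R^-1 * (entropy mu (@word I n) + s * mean_log_norm A mu n))
    @ \oo --> F /\
  forall n, n%:R * F <= entropy mu (@word I n) + s * mean_log_norm A mu n.
Proof.
have [h [Wh hW]] : exists h : R,
    (fun n => n%:R^-1 * entropy mu (@word I n)) @ \oo --> h /\
    forall n, n%:R * h <= entropy mu (@word I n).
  apply: (@fekete R (fun n => entropy mu (@word I n))).
    by move=> m n; exact: entropy_word_subadditive.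
  by move=> n; apply: entropy_ge0; exact: finite_rv_word.
have L0 n : 0 <= mean_log_norm A mu n.
  by apply: sumr_ge0 => w _; rewrite mulr_ge0 ?mass_ge0// ln_ge0.
have [L [WL LW]] := fekete mean_log_norm_subadditive L0.
exists (h + s * L).
  rewrite /free_energy (metric_entropy_word muinv Wh); rewrite EFinD EFinM.
  congr (_ + _ * _)%E.
  apply: cvg_lim => //.
  rewrite (_ : (fun n => _) = fun n => (n%:R^-1 * mean_log_norm A mu n)%:E).
    by apply: cvg_EFin; [exact: nearW|].
  by apply/funext => n; rewrite lyapunov_integral.
split; last by move=> n; rewrite mulrDr lerD// mulrCA ler_wpM2l// ltW.
rewrite (_ : (fun n => _) = fun n => n%:R^-1 * entropy mu (@word I n) +
    s * (n%:R^-1 * mean_log_norm A mu n)).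
  by apply: cvgD => //; apply: cvgMr.
by apply/funext => n; rewrite mulrDr mulrCA.
Qed.

(** Averaging the hypothesis over words bounds entropy plus energy at length [n] below by [n P - K],
    and [K] disappears in the rate. Words of mass zero have no weight in the average. *)
Lemma free_energy_ge (P K : R) :
  (forall n (w : n.-tuple I), 0 < mass mu (@word I n) w ->
    n%:R * P + ln (mass mu (@word I n) w) <=
    K + s * ln (operator_norm (word_product A w))) ->
  (P%:E <= free_energy A s mu)%E.
Proof.
move=> lower; have [F -> [cF _]] := free_energy_limit; rewrite lee_fin.
suff H n : n%:R * P <= entropy mu (@word I n) + s * mean_log_norm A mu n + K.
  exact: rate_le H (@invn_mulKn_cvg R P) cF.
have mW := @finite_rv_word I n.
rewrite /entropy /mean_log_norm mulr_sumr -sumrN -big_split/=.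
rewrite -{1}(expectation_const mu (n%:R * P) mW).
rewrite -[K in leRHS](expectation_const mu K mW) -big_split/=.
apply: ler_sum => w _; have [->|w0] := eqVneq (mass mu (@word I n) w) 0.
  by rewrite !mul0r mulr0 oppr0 !addr0.
have {w0} wp : 0 < mass mu (@word I n) w by rewrite lt_neqAle eq_sym w0
  mass_ge0.
by have := ler_wpM2l (ltW wp) (lower n w wp); lra.
Qed.

Section gibbs_measure.
Context (rho : probability (shift_space I) R) (P K : R).
Hypothesis rho0 : forall n w, 0 < mass rho (@word I n) w.
Hypothesis upper : forall n (w : n.-tuple I),
  s * ln (operator_norm (word_product A w)) <=
  K + n%:R * P + ln (mass rho (@word I n) w).

Lemma mean_log_norm_le_gibbs n :
  s * mean_log_norm A mu n <= K + n%:R * P +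
    \sum_w mass mu (@word I n) w * ln (mass rho (@word I n) w).
Proof.
have mW := @finite_rv_word I n.
rewrite -(expectation_const mu (K + n%:R * P) mW) -big_split/= mulr_sumr.
by apply: ler_sum => w _; rewrite mulrCA -mulrDr ler_wpM2l ?mass_ge0.
Qed.

Lemma free_energy_le_gibbs : (free_energy A s mu <= P%:E)%E.
Proof.
have [F -> [cF _]] := free_energy_limit; rewrite lee_fin.
suff H n : entropy mu (@word I n) + s * mean_log_norm A mu n <= n%:R * P + K.
  exact: rate_le H cF (@invn_mulKn_cvg R P).
have mW := @finite_rv_word I n.
apply: le_trans (lerD (gibbs_inequality (q := mass rho (@word I n)) mW _ _ _)
  (mean_log_norm_le_gibbs n)) _.
- by move=> w; exact: ltW.
- by rewrite sum_mass.
- by move=> w r0; have := rho0 w; rewrite r0 ltxx.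
by lra.
Qed.

(* Gibbs' inequality against [rho] tilted by [expR a] on the cylinder; letting
   [a] grow while [expR a * rho] stays bounded gives absolute continuity. *)
Lemma cylinder_le_gibbs (a : R) n (S : pred (seq I)) :
  free_energy A s mu = P%:E -> 0 <= a ->
  a * fine (mu (cylinder n S)) <= K + expR a * fine (rho (cylinder n S)).
Proof.
move=> FP a0; have mW := @finite_rv_word I n.
have [F + [_ nF]] := free_energy_limit; rewrite FP => -[PF].
have {nF} := nF n; rewrite -PF => /le_trans /(_ (lerD (lexx _)
  (mean_log_norm_le_gibbs n))).
pose t (w : n.-tuple I) := mass rho (@word I n) w * expR (a * (S w)%:R).
pose W := \sum_w t w.
have t0 w : 0 < t w by rewrite mulr_gt0 ?expR_gt0.
have W0 : 0 < W.
  rewrite /W (bigD1 (@word I n point))//= ltr_wpDr// sumr_ge0// => w _;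
    exact: ltW.
have ge := gibbs_inequality (mu := mu) (q := fun w => t w / W) mW _ _ _.
have {}ge : entropy mu (@word I n) <=
    - \sum_w mass mu (@word I n) w * ln (t w / W).
  apply: ge.
  - by move=> w; rewrite divr_ge0// ltW.
  - by rewrite -mulr_suml divff// gt_eqF.
  - by move=> w /eqP; rewrite gt_eqF// divr_gt0.
have lnt w : ln (t w / W) = ln (mass rho (@word I n) w) + a * (S w)%:R - ln W.
  by rewrite ln_div ?posrE// lnM ?posrE ?expR_gt0// expRK.
have muS (nu : probability (shift_space I) R) : fine (nu (cylinder n S)) =
    \sum_w mass nu (@word I n) w * (S w)%:R.
  rewrite cylinder_word (probability_finite_rv nu
    (fun w : n.-tuple I => S w) mW).
  by rewrite big_mkcond/=; apply: eq_bigr => w _; case: (S w);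
    rewrite ?mulr1 ?mulr0.
have sumln : \sum_w mass mu (@word I n) w * ln (t w / W) =
    \sum_w mass mu (@word I n) w * ln (mass rho (@word I n) w) +
    a * fine (mu (cylinder n S)) - ln W.
  rewrite muS mulr_sumr -[X in _ - X](expectation_const mu
    (ln W) mW) -sumrN -!big_split/=.
  by apply: eq_bigr => w _; rewrite lnt !mulrDr mulrN mulrCA.
(* The normalizing constant is [W = 1 + (expR a - 1) * rho] of the cylinder, and
   [ln (1 + x) <= x]. *)
have lnW : ln W <= expR a * fine (rho (cylinder n S)).
  have <- : \sum_w mass rho (@word I n) w +
      (expR a - 1) * fine (rho (cylinder n S)) = W.
    rewrite muS mulr_sumr -big_split/=; apply: eq_bigr => w _.
    rewrite /t; case: (S w); rewrite ?mulr1 ?mulr0 ?expR0 ?mulr1 ?addr0//.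
    by rewrite mulrBl mul1r addrC subrK mulrC.
  have r0 : 0 <= fine (rho (cylinder n S)) by rewrite fine_ge0.
  rewrite sum_mass//; apply: le_trans (le_ln1Dx _) _.
    apply: lt_le_trans (_ : -1 < 0) _; first by rewrite oppr_lt0.
    by rewrite mulr_ge0// subr_ge0 -expR0 ler_expR.
  by rewrite ler_wpM2r// gerBl.
rewrite sumln in ge => nP.
move: ge lnW nP; move: (entropy _ _) (a * _) (expR a * _) (ln W) (n%:R * P)
  (\sum_w _).
move=> H x y z u v; lra.
Qed.

Lemma abs_continuous_gibbs (B : set (shift_space I)) :
  free_energy A s mu = P%:E -> measurable B -> rho B = 0%E -> mu B = 0%E.
Proof.
move=> FP mB rB; rewrite -(probability_fineK mu mB); congr (_%:E).
apply/eqP; rewrite eq_le fine_ge0// andbT; apply/ler_addgt0Pl => e e0;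
  rewrite addr0.
(* With this tilt, [(|K| + 1) / a] is exactly [e / 2]. *)
pose a := (`|K| + 1) * 2 / e.
have a0 : 0 < a by rewrite divr_gt0// mulr_gt0// ltr_wpDl.
(* The bound [expR (- a)] on the [rho]-error keeps [expR a * rho] of the cylinder at most 1, since
   [rho B = 0]; the bound [e / 2] controls the error for [mu]. *)
pose e' := Num.min (e / 2) (expR (- a)).
have e'0 : 0 < e' by rewrite lt_min divr_gt0//= expR_gt0.
have [n [S [muS rhoS]]] := measurable_approximable mu rho mB e'0.
have mS := @measurable_cylinder I n S; have mY := measurable_setY mB mS.
rewrite -(probability_fineK mu mY) lte_fin in muS.
rewrite -(probability_fineK rho mY) lte_fin in rhoS.
have := cylinder_le_gibbs n S FP (ltW a0).
have := probability_dist_setY mu mB mS; have := probability_dist_setY rho mB mS.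
rewrite rB/= sub0r normrN ger0_norm ?fine_ge0// => /le_lt_trans /(_ rhoS) rS.
move=> /le_lt_trans /(_ muS); rewrite ltr_norml => /andP[_ mS'].
move=> /le_trans /(_ (_ : _ <= `|K| + 1)) aS.
have {}aS : a * fine (mu (cylinder n S)) <= `|K| + 1.
  apply: aS; rewrite lerD ?ler_norm//.
  apply: le_trans (ler_wpM2l (expR_ge0 _) (ltW rS)) _.
  apply: le_trans (ler_wpM2l (expR_ge0 _) (_ : _ <= expR (- a))) _.
    by rewrite ge_min lexx orbT.
  by rewrite -expRD subrr expR0.
have e2 : fine (mu (cylinder n S)) <= e / 2.
  rewrite -(ler_pM2l a0) (le_trans aS)// /a.
  by rewrite mulrA divfK ?gt_eqF// mulfK.
have : fine (mu B) - fine (mu (cylinder n S)) <= e / 2.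
  by rewrite (le_trans (ltW mS'))// ge_min lexx.
by rewrite lerBlDr => /le_trans; apply; rewrite [leRHS]splitr lerD2l.
Qed.

End gibbs_measure.
End invariant.
End free_energy.

(** * Invariant Hahn sets and ergodicity *)

Section real_probability.
Context d (T : measurableType d) (R : realType).
Implicit Types (mu nu : probability T R) (A B : set T).

Lemma probability_splitI mu A B : measurable A -> measurable B ->
  fine (mu A) = fine (mu (A `&` B)) + fine (mu (A `\` B)).
Proof.
move=> mA mB; apply: EFin_inj.
have mI : measurable (A `&` B) by exact: measurableI.
have mD : measurable (A `\` B) by exact: measurableD.
by rewrite EFinD !probability_fineK// addeC; exact: measureDI.
Qed.

Lemma fine_probabilityC mu B : measurable B ->
  fine (mu (~` B)) = 1 - fine (mu B).
Proof.
move=> mB; have := probability_splitI mu measurableT mB.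
by rewrite setTI setTD probability_setT/= => ->; rewrite addrC addKr.
Qed.

Lemma fine_probability_le mu A B : measurable A -> measurable B ->
  A `<=` B -> fine (mu A) <= fine (mu B).
Proof.
move=> mA mB AB; rewrite -lee_fin !probability_fineK//.
by apply: le_measure; rewrite ?inE.
Qed.

Lemma le_same_probability mu nu :
  (forall B, measurable B -> fine (nu B) <= fine (mu B)) -> same_measure nu mu.
Proof.
move=> le B mB; rewrite -[LHS]probability_fineK// -[RHS]probability_fineK//.
congr (_%:E); apply/eqP; rewrite eq_le le//=.
have := le _ (measurableC mB); rewrite !fine_probabilityC//.
by rewrite lerD2l lerN2.
Qed.

Lemma fine_probability_bigcup_cvg mu (F : (set T)^nat) :
  (forall n, measurable (F n)) -> {homo F : n m / (n <= m)%N >-> n `<=` m} ->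
  (fun n => fine (mu (F n))) @ \oo --> fine (mu (\bigcup_n F n)).
Proof.
move=> mF ndF; have mU : measurable (\bigcup_n F n) by exact:
  bigcupT_measurable.
have : mu \o F @ \oo --> mu (\bigcup_n F n).
  apply: nondecreasing_cvg_mu => // n m nm; apply/subsetPset; exact: ndF.
by rewrite -[X in _ --> X]probability_fineK// => /fine_cvgP[].
Qed.

End real_probability.

Section hahn.
Context d (T : measurableType d) (R : realType).
Implicit Types (mu nu : probability T R).

Lemma hahn_maximizer mu nu : exists2 P, measurable P &
  forall B, measurable B ->
    fine (nu B) - fine (mu B) <= fine (nu P) - fine (mu P).
Proof.
pose k : {charge set T -> \bar R} :=
  cadd (charge_of_finite_measure nu) (copp (charge_of_finite_measure mu)).
have kE B : measurable B -> k B = (fine (nu B) - fine (mu B))%:E.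
  move=> mB; rewrite EFinB !probability_fineK//.
have [P [N [[mP posP] [mN negN] PN PN0]]] := Hahn_decomposition k.
exists P => // B mB.
have mBP := measurableI _ _ mB mP; have mBDP := measurableD mB mP.
have mPDB := measurableD mP mB.
have k1 : fine (nu (B `\` P)) - fine (mu (B `\` P)) <= 0.
  rewrite -lee_fin -kE//; apply: negN => // x [_ Px].
  by have [//|] : (P `|` N) x by rewrite PN.
have k2 : 0 <= fine (nu (P `\` B)) - fine (mu (P `\` B)).
  by rewrite -lee_fin -kE//; apply: posP => // x [].
rewrite (probability_splitI nu mB mP) (probability_splitI mu mB mP).
rewrite (probability_splitI nu mP mB) (probability_splitI mu mP mB).
by rewrite [P `&` B]setIC; lra.
Qed.

(** The difference [nu - mu] is modular: its values on the union and the intersection of two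
    maximizers add up to [2 M] and neither exceeds [M], so both equal [M]. Continuity along
    increasing unions does the rest. *)
Lemma maximizer_bigcup mu nu (M : R) (F : (set T)^nat) :
  (forall B, measurable B -> fine (nu B) - fine (mu B) <= M) ->
  (forall n, measurable (F n) /\ fine (nu (F n)) - fine (mu (F n)) = M) ->
  fine (nu (\bigcup_n F n)) - fine (mu (\bigcup_n F n)) = M.
Proof.
move=> maxM FM; have mF n : measurable (F n) by case: (FM n).
pose G n := \big[setU/set0]_(i < n.+1) F i.
have mG n : measurable (G n) by apply: bigsetU_measurable.
have GM n : fine (nu (G n)) - fine (mu (G n)) = M.
  elim: n => [|n IH]; first by rewrite /G big_ord_recr big_ord0/= set0U;
    case: (FM 0%N).
  have GS : G n.+1 = G n `|` F n.+1 by rewrite /G big_ord_recr.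
  have mI := measurableI _ _ (mG n) (mF n.+1).
  have mU := measurableU _ _ (mG n) (mF n.+1).
  have UE (rho : probability T R) : fine (rho (G n `|` F n.+1)) =
      fine (rho (G n)) + fine (rho (F n.+1)) - fine (rho (G n `&` F n.+1)).
    rewrite (probability_splitI rho mU (mF n.+1)) setIUl setIid setDUl setDv
      setU0.
    rewrite [_ `|` F n.+1]setUidr; last by move=> x [].
    by rewrite (probability_splitI rho (mG n) (mF n.+1)); ring.
  have := maxM _ mI; have := maxM _ mU; have [_] := FM n.+1.
  by rewrite GS !UE; move: IH; lra.
have ndG : {homo G : n m / (n <= m)%N >-> n `<=` m}.
  by move=> n m nm; exact: subset_bigsetU.
have UG : \bigcup_n G n = \bigcup_n F n by exact: bigcup_bigsetU_bigcup.
rewrite -UG; apply: (@cvg_unique _ (@Rhausdorff R)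
  ((fun n => fine (nu (G n)) - fine (mu (G n))) @ \oo)).
  by apply: cvgB; exact: fine_probability_bigcup_cvg.
by rewrite (_ : (fun n => _) = fun=> M); [exact: cvg_cst|exact/funext].
Qed.

Lemma maximizer_bigcap mu nu (M : R) (F : (set T)^nat) :
  (forall B, measurable B -> fine (nu B) - fine (mu B) <= M) ->
  (forall n, measurable (F n) /\ fine (nu (F n)) - fine (mu (F n)) = M) ->
  fine (nu (\bigcap_n F n)) - fine (mu (\bigcap_n F n)) = M.
Proof.
move=> maxM FM; have mF n : measurable (F n) by case: (FM n).
have flip B : measurable B ->
    fine (mu (~` B)) - fine (nu (~` B)) = fine (nu B) - fine (mu B).
  by move=> mB; rewrite !fine_probabilityC//; ring.
rewrite -flip; last exact: bigcapT_measurable.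
rewrite setC_bigcap; apply: maximizer_bigcup.
  move=> B mB; rewrite -[B]setCK flip; last exact: measurableC.
  by apply: maxM; exact: measurableC.
move=> n; split; first exact: measurableC.
by rewrite flip//; case: (FM n).
Qed.

Section invariant.
Context (f : T -> T) (mu nu : probability T R).
Hypotheses (mf : measurable_fun setT f) (muinv : invariant_measure f mu)
  (nuinv : invariant_measure f nu).

(* The maximizers of [nu - mu] are its Hahn sets; they are stable under preimages
   and countable unions and intersections, so the limsup of the preimages of one
   of them is a strictly invariant Hahn set. *)
Lemma invariant_hahn_set : exists D, [/\ measurable D, f @^-1` D = D,
  forall B, measurable B -> B `<=` D -> fine (mu B) <= fine (nu B) &
  forall B, measurable B -> B `<=` ~` D -> fine (nu B) <= fine (mu B)].
Proof.
have [P mP maxP] := hahn_maximizer mu nu.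
pose M := fine (nu P) - fine (mu P).
pose Pn n := iter n f @^-1` P.
have PnM n : measurable (Pn n) /\ fine (nu (Pn n)) - fine (mu (Pn n)) = M.
  split; first exact: measurable_iter_preimage.
  by rewrite /Pn (invariant_iter mf muinv n mP) (invariant_iter mf nuinv n mP).
pose U n := \bigcup_k Pn (n + k)%N.
have UM n : measurable (U n) /\ fine (nu (U n)) - fine (mu (U n)) = M.
  split; first by apply: bigcupT_measurable => k; case: (PnM (n + k)%N).
  by apply: maximizer_bigcup => // k; exact: PnM.
pose D := \bigcap_n U n.
have mD : measurable D by apply: bigcapT_measurable => n; case: (UM n).
have DM : fine (nu D) - fine (mu D) = M by exact: maximizer_bigcap.
have PnS n x : Pn n (f x) = Pn n.+1 x by rewrite /Pn/= -iterSr.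
exists D; split=> //.
- apply/seteqP; split=> x Dx n _.
    by have [k _] := Dx n Logic.I; rewrite PnS -addnS; exists k.+1.
  have [k _] := Dx n.+1 Logic.I; rewrite addSn -PnS; by exists k.
(* If [mu B] exceeded [nu B] inside [D], removing [B] from [D] would raise [nu - mu] above its
   maximum; outside [D], adding [B] is the symmetric argument. *)
- move=> B mB BD; have mDB := measurableD mD mB.
  have := maxP _ mDB; move: DM; rewrite -/M.
  rewrite (probability_splitI nu mD mB) (probability_splitI mu mD mB).
  by rewrite (setIidr BD); lra.
- move=> B mB BD; have mDB := measurableU _ _ mD mB.
  have := maxP _ mDB; move: DM; rewrite -/M.
  rewrite (probability_splitI nu mDB mB) (probability_splitI mu mDB mB).
  rewrite setIUl setIid (_ : D `&` B = set0) ?set0U; last first.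
    by apply/seteqP; split=> // x [Dx /BD].
  rewrite setDUl setDv setU0 (_ : D `\` B = D); first by lra.
  by apply/seteqP; split=> [x []//|x Dx]; split=> // /BD.
Qed.

End invariant.

Lemma le_probability_null mu nu D : measurable D -> fine (nu D) = 0 ->
  (forall B, measurable B -> B `<=` ~` D -> fine (nu B) <= fine (mu B)) ->
  forall B, measurable B -> fine (nu B) <= fine (mu B).
Proof.
move=> mD nuD le B mB.
have mI := measurableI _ _ mB mD; have mDB := measurableD mB mD.
have := fine_probability_le nu mI mD (@subIsetr _ _ _); rewrite nuD => nI.
have := fine_probability_le mu mDB mB (@subDsetl _ _ _).
have : fine (nu (B `\` D)) <= fine (mu (B `\` D)) by apply: le => // x [].
by rewrite (probability_splitI nu mB mD); lra.
Qed.

(** By ergodicity the invariant Hahn set where [nu] dominates has [mu]-measure 0 or 1. If 0, it is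
    also [nu]-null and [nu <= mu] everywhere; if 1, then [mu <= nu] everywhere. Domination between
    probabilities is equality. *)
Lemma ergodic_abs_continuous (f : T -> T) mu nu : measurable_fun setT f ->
  invariant_measure f mu -> invariant_measure f nu -> ergodic f mu ->
  (forall B, measurable B -> mu B = 0%E -> nu B = 0%E) -> same_measure nu mu.
Proof.
move=> mf muinv nuinv erg ac.
have [D [mD fD Dpos Dneg]] := invariant_hahn_set mf muinv nuinv.
have [muD|muD] := erg D mD fD.
  by apply/le_same_probability/(le_probability_null mD _ Dneg); rewrite ac.
suff H : same_measure mu nu by move=> B mB; rewrite H.
apply/le_same_probability/(le_probability_null (measurableC mD)).
  by rewrite fine_probabilityC// muD/= subrr.
by move=> B mB; rewrite setCK; exact: Dpos.
Qed.

(** The invariant Hahn set separates the measures: any other choice among the values 0 and 1 would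
    make one measure dominate the other. *)
Lemma ergodic_separation (f : T -> T) mu nu : measurable_fun setT f ->
  invariant_measure f mu -> invariant_measure f nu ->
  ergodic f mu -> ergodic f nu -> ~ same_measure mu nu ->
  exists D, [/\ measurable D, f @^-1` D = D, mu D = 0%E & nu D = 1%E].
Proof.
move=> mf muinv nuinv mue nue dif.
have [D [mD fD Dpos Dneg]] := invariant_hahn_set mf muinv nuinv.
exists D; have [nuD|nuD] := nue D mD fD.
  have H : same_measure nu mu.
    by apply/le_same_probability/(le_probability_null mD _ Dneg); rewrite nuD.
  by exfalso; apply: dif => B mB; rewrite H.
have [muD|muD] := mue D mD fD => //.
exfalso; apply: dif.
apply/le_same_probability/(le_probability_null (measurableC mD)).
  by rewrite fine_probabilityC// muD/= subrr.
by move=> B mB; rewrite setCK; exact: Dpos.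
Qed.

End hahn.

(** For an invariant [B] close to a cylinder [C], the set [B] is close to [C] intersected with its
    preimage under [iter N f], whose measure is the square of that of [C]. Hence [mu B] equals its
    own square. *)
Lemma mixing_ergodic (R : realType) (I : alphabetType)
    (mu : probability (shift_space I) R) (f : shift_space I -> shift_space I) :
  measurable_fun setT f -> invariant_measure f mu ->
  (forall n (S : pred (seq I)), exists N,
    fine (mu (cylinder n S `&` iter N f @^-1` cylinder n S)) =
    fine (mu (cylinder n S)) ^+ 2) ->
  ergodic f mu.
Proof.
move=> mf muinv mix B mB fB; set t := fine (mu B).
have iterB N : iter N f @^-1` B = B.
  by elim: N => [//|N IH]; rewrite -[RHS]IH -[in RHS]fB.
have t0 : 0 <= t by rewrite fine_ge0.
have t1 : t <= 1 by rewrite -lee_fin probability_fineK// probability_le1.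
suff tt : t = t ^+ 2.
  have /eqP : t * (1 - t) = 0 by rewrite mulrBr mulr1 -expr2 -tt subrr.
  rewrite mulf_eq0 subr_eq0 => /orP[/eqP t00|/eqP t11]; [left|right];
  by rewrite -(probability_fineK mu mB) -/t ?t00 -?t11.
apply/eqP; rewrite -subr_eq0 -normr_le0; apply/ler_addgt0Pl => e e0;
  rewrite addr0.
(* Two errors [e / 4] come from [C] and its preimage, and two more from replacing the square of
   [mu C] by that of [mu B]. *)
have e40 : 0 < e / 4 by rewrite divr_gt0.
have [n [S [muS _]]] := measurable_approximable mu mu mB e40.
set C := cylinder n S in muS; have mC : measurable C by exact:
  measurable_cylinder.
have mY := measurable_setY mB mC.
rewrite -(probability_fineK mu mY) lte_fin in muS.
have [N muN] := mix n S; rewrite -/C in muN.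
have mNC : measurable (iter N f @^-1` C) by exact: measurable_iter_preimage.
have mNY : measurable (iter N f @^-1` (B `+` C)) by exact:
  measurable_iter_preimage.
have mI := measurableI _ _ mC mNC.
have d1 := probability_dist_setY mu mB mC.
have d2 := probability_dist_setY mu mB mI.
have d3 : fine (mu (B `+` (C `&` iter N f @^-1` C))) <= 2 * fine (mu (B `+` C)).
  have mW := measurableU _ _ mY mNY.
  apply: (@le_trans _ _ (fine (mu ((B `+` C) `|` iter N f @^-1` (B `+` C))))).
    apply: fine_probability_le => //; first exact: measurable_setY.
    have iB x : B x <-> B (iter N f x) by rewrite -[in X in X <-> _](iterB N).
    move=> x; rewrite /setY/= iB; have [] := pselect (C x);
    have [] := pselect (C (iter N f x)); rewrite -iB; tauto.
  rewrite -lee_fin EFinM !probability_fineK//.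
  apply: le_trans (measureU2 _ mY mNY) _.
  have eN : (mu (iter N f @^-1` (B `+` C)) <= mu (B `+` C))%E.
    by rewrite (invariant_iter mf muinv N mY).
  by rewrite mule_natl mule2n; apply: leeD.
rewrite muN in d2; set c := fine (mu C) in d1 d2.
have c0 : 0 <= c by rewrite fine_ge0.
have c1 : c <= 1 by rewrite -lee_fin probability_fineK// probability_le1.
have d4 : `|c ^+ 2 - t ^+ 2| <= 2 * `|t - c|.
  rewrite subr_sqr normrM distrC mulrC ler_wpM2r// ger0_norm ?addr_ge0//; lra.
have -> : t - t ^+ 2 = (t - c ^+ 2) + (c ^+ 2 - t ^+ 2) by ring.
apply: le_trans (ler_normD _ _) _.
have : `|t - c| <= e / 4 by exact: le_trans d1 (ltW muS).
have := le_trans d2 d3; move: muS d4; rewrite -/c.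
by move: `|t - c ^+ 2| `|c ^+ 2 - _| `|t - c| (fine _) => x y z u; lra.
Qed.

(** * Bernoulli measures and blocks *)

Lemma pushforward_probability d d' (T : measurableType d)
    (U : measurableType d') (R : realType) (mu : probability T R) (f : T -> U) :
  measurable_fun setT f ->
  exists nu : probability U R, forall B, nu B = mu (f @^-1` B).
Proof.
move=> mf; pose F : {mfun T >-> U} := HB.pack f
  (isMeasurableFun.Build _ _ _ _ f mf).
by exists (distribution mu F).
Qed.

Lemma average_probability d (T : measurableType d) (R : realType)
    (nu1 nu2 : probability T R) :
  exists mu : probability T R, forall B, mu B = (2^-1%:E * (nu1 B + nu2 B))%E.
Proof.
have half0 : (0 : R) <= 2^-1 by [].
pose m := mscale (NngNum half0) (measure_add nu1 nu2).
have mE B : m B = (2^-1%:E * (nu1 B + nu2 B))%E.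
  by congr (_ * _)%E; exact: measure_addE.
have m1 : m setT = 1%E.
  rewrite mE !probability_setT -EFinD -EFinM; congr (_%:E).
  by rewrite -[1 + 1]/(2 : R) mulVf.
pose P : probability T R := HB.pack m (Measure_isProbability.Build _ _ R m m1).
by exists P.
Qed.

Section bernoulli_measure.
Context (I : alphabetType) (R : realType) (p : I -> R).
Hypotheses (p0 : forall i, 0 < p i) (p1 : \sum_i p i = 1).

(** Cumulative sums: the intervals from [lo i] to [hi i], closed on the left, tile [[0, 1)] with
    lengths [p i]. *)
Let c (k : nat) : R := \sum_(0 <= j < k) p (nth point (enum I) j).
Let lo (i : I) := c (index i (enum I)).
Let hi (i : I) := c (index i (enum I)).+1.

Let hiE i : hi i = lo i + p i.
Proof. by rewrite /hi /c big_nat_recr//= nth_index// mem_enum. Qed.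

Let c_le j k : (j <= k)%N -> c j <= c k.
Proof.
move=> jk; rewrite /c (@big_cat_nat _ _ _ j 0 k)//= lerDl.
by apply: sumr_ge0 => i _; exact: ltW.
Qed.

Let c1 : c #|I| = 1.
Proof. by rewrite -p1 -big_enum/= (big_nth point) cardE. Qed.

Let lo0 i : 0 <= lo i.
Proof. by apply: sumr_ge0 => j _; exact: ltW. Qed.

Let hi1 i : hi i <= 1.
Proof. by rewrite -c1 c_le// cardE index_mem mem_enum. Qed.

Let lo_hi_exists (x : R) : 0 <= x < 1 -> exists i, lo i <= x < hi i.
Proof.
move=> /andP[x0 x1].
have [k kI /andP[ck cSk]] : exists2 k, (k < #|I|)%N & c k <= x < c k.+1.
  have : x < c #|I| by rewrite c1.
  elim: #|I| => [|n IH]; first by rewrite /c big_geq// ltNge x0.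
  have [cn|cn] := leP (c n) x; first by exists n; rewrite // cn.
  by have [k kn kx] := IH cn; exists k => //; exact: ltnW.
exists (nth point (enum I) k).
by rewrite /lo /hi index_uniq ?enum_uniq -?cardE// ck.
Qed.

Let lo_hi_unique (x : R) i j : lo i <= x < hi i -> lo j <= x < hi j -> i = j.
Proof.
have le (a b : nat) : c a <= x -> x < c b.+1 -> (a <= b)%N.
  move=> ca cb; rewrite leqNgt; apply/negP => /c_le ba.
  by have := lt_le_trans cb (le_trans ba ca); rewrite ltxx.
move=> /andP[li hi'] /andP[lj hj].
rewrite -[i](@nth_index _ point _ (enum I)) ?mem_enum//.
rewrite -[j in RHS](@nth_index _ point _ (enum I)) ?mem_enum//.
by congr nth; apply/eqP; rewrite eqn_leq; apply/andP; split; exact: le.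
Qed.

Let digit (x : R) : I := odflt point [pick i | lo i <= x < hi i].
Let expand (x : R) : R := (x - lo (digit x)) / p (digit x).
Let unfold (x : R) (k : nat) : I := digit (iter k expand x).
(** Prefixing a letter [i] applies the inverse branch [lo i + p i * a] of the expanding map, so
    words code nested intervals. *)
Let left_end (w : seq I) : R := foldr (fun i a => lo i + p i * a) 0 w.
Let len (w : seq I) : R := \prod_(i <- w) p i.

Let digitE x i : lo i <= x < hi i -> digit x = i.
Proof.
move=> xi; rewrite /digit; case: pickP => [j xj|/(_ i)]; last by rewrite xi.
exact: lo_hi_unique xj xi.
Qed.

Let len0 w : 0 < len w.
Proof. by apply: prodr_gt0 => i _. Qed.

Let left_end_itv w : 0 <= left_end w /\ left_end w + len w <= 1.
Proof.
elim: w => [|i w [IH0 IH1]] /=; first by rewrite /len big_nil add0r.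
split; first by rewrite addr_ge0// mulr_ge0// ltW.
rewrite /len big_cons -/(len w) -addrA -mulrDr (le_trans _
  (hi1 i))// hiE lerD2l.
by rewrite ler_piMr// ltW.
Qed.

Let unfold_prefix w x : 0 <= x < 1 ->
  (mkseq (unfold x) (size w) == w) = (left_end w <= x < left_end w + len w).
Proof.
elim: w x => [|i w IH] x x01; first by rewrite /len big_nil add0r x01.
have unfoldS : mkseq (unfold x) (size w).+1 =
    digit x :: mkseq (unfold (expand x)) (size w).
  rewrite /mkseq/= -[1%N]addn0 iotaDl -map_comp; congr cons.
  by apply: eq_map => k; rewrite /= /unfold -iterSr.
have [w0 w1] := left_end_itv w.
rewrite [size _]/= unfoldS eqseq_cons /= /len big_cons -/(len w).
have [j jx] := lo_hi_exists x01; rewrite (digitE jx).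
have [<-|ji] := eqVneq j i => /=.
  have ej : expand x = (x - lo j) / p j by rewrite /expand (digitE jx).
  have e01 : 0 <= expand x < 1.
    move/andP: jx => [j1 j2]; rewrite ej divr_ge0 ?subr_ge0// ?(ltW (p0 _))//=.
    by rewrite ltr_pdivrMr// mul1r ltrBlDl -hiE.
  rewrite IH// ej ler_pdivlMr// ltr_pdivrMr//.
  by rewrite lerBrDl ltrBlDl -addrA -mulrDr ![_ * p j]mulrC.
apply/esym/negP => /andP[xl xr]; apply/negP: ji; rewrite negbK; apply/eqP.
apply: (lo_hi_unique jx); apply/andP; split.
  by apply: le_trans xl; rewrite lerDl mulr_ge0// ltW.
apply: lt_le_trans xr _; rewrite hiE -addrA -mulrDr lerD2l.
by rewrite ler_piMr// ltW.
Qed.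

(* Image of the Lebesgue measure of [0, 1) by the itineraries of the piecewise
   affine expanding map whose branches have slopes [(p i)^-1]: the words of
   length n code consecutive intervals of lengths [\prod_(i <- w) p i]. *)
Lemma bernoulli_measure_exists : exists mu : probability (shift_space I) R,
  forall w : seq I,
    fine (mu (cylinder (size w) (pred1 w))) = \prod_(i <- w) p i.
Proof.
pose D : set (measurableTypeR R) := `[0, 1[%classic.
have mD : measurable D by exact: measurable_itv.
pose m := mrestr lebesgue_measure mD.
have m1 : m setT = 1%E.
  rewrite /m /mrestr setTI /D lebesgue_measure_itv/= lte_fin ltr01.
  by rewrite -EFinB subr0.
pose P : probability (measurableTypeR R) R :=
  HB.pack m (Measure_isProbability.Build _ _ R m m1).
(* The measure [P] lives on [[0, 1)]; the constant value elsewhere only makes [code] total and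
   measurable. *)
pose code (x : measurableTypeR R) : shift_space I :=
  fun k => if (0 <= x < 1) then unfold x k else point.
have codeD w : code @^-1` (cylinder (size w) (pred1 w)) `&` D =
    `[left_end w, left_end w + len w[%classic.
  have [w0 w1] := left_end_itv w.
  apply/seteqP; split=> x /=.
    move=> [cw]; rewrite /D/= in_itv/= => x01.
    by rewrite in_itv/= -unfold_prefix//; move: cw;
      rewrite /cylinder/= /code x01.
  rewrite in_itv/= => xw.
  have x01 : 0 <= x < 1.
    move/andP: xw => [xl xr]; rewrite (le_trans w0 xl)/=.
    exact: lt_le_trans xr w1.
  by rewrite /D/= in_itv/= x01; split=> //; rewrite /cylinder/= /code x01
    unfold_prefix.
have mcyl w : measurable (code @^-1` (cylinder (size w) (pred1 w))).
  rewrite -[X in measurable X]setIT -(setUv D) setIUr codeD.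
  apply: measurableU; first exact: measurable_itv.
  have outD x : (~` D) x -> code x = fun=> point.
    by rewrite /D/= in_itv/= /code => /negP/negPf x01; apply/funext => k;
      rewrite x01.
  have [pw|pw] := boolP (mkseq (fun=> point : I) (size w) == w).
    rewrite (_ : _ `&` _ = ~` D); first exact: measurableC.
    by apply/seteqP; split=> [x []//|x Dx]; split=> //;
      rewrite /cylinder/= (outD x).
  rewrite (_ : _ `&` _ = set0) //; apply/seteqP; split=> // x [+ Dx].
  by rewrite /cylinder/= (outD x)// (negPf pw).
have mcode : measurable_fun setT code.
  apply: measurable_to_shift => k.
  have mW : finite_rv (fun x => word k.+1 (code x)).
    move=> w; rewrite (_ : _ @^-1` _ = code @^-1` (cylinder (size w) (pred1
      (tval w)))).
      exact: mcyl.
    apply/seteqP; split=> x; rewrite /cylinder/= size_tuple -val_word.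
      by move=> ->.
    by move=> /eqP xw; exact: val_inj.
  rewrite (_ : (fun x => _) = (fun w : k.+1.-tuple I =>
    tnth w ord_max) \o (fun x => word k.+1 (code x))).
    exact: (finite_rv_comp _ mW).
  by apply/funext => x /=; rewrite tnth_mktuple.
have [mu muE] := pushforward_probability P mcode.
exists mu => w; rewrite muE.
have -> : P (code @^-1` (cylinder (size w) (pred1 w))) =
    lebesgue_measure (`[left_end w, left_end w + len w[%classic : set
      (measurableTypeR R)).
  by rewrite -codeD.
rewrite lebesgue_measure_itv/= lte_fin ltrDl len0 -EFinB/=.
by rewrite addrC addKr.
Qed.

End bernoulli_measure.

(** Words are sequences here, not tuples, so that inductions on words carry no length index. *)
Definition word_mass (R : realType) (I : alphabetType)
    (mu : probability (shift_space I) R) (w : seq I) : R :=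
  fine (mu (cylinder (size w) (pred1 w))).

Lemma mass_word (R : realType) (I : alphabetType)
    (mu : probability (shift_space I) R) n (w : n.-tuple I) :
  mass mu (@word I n) w = word_mass mu w.
Proof.
rewrite /mass /word_mass; congr (fine (mu _)).
apply/seteqP; split=> x; rewrite /cylinder/= size_tuple.
  by move=> <-; rewrite val_word.
by move=> /eqP xw; apply: val_inj; exact: etrans (val_word n x) xw.
Qed.

Section bernoulli_shift.
Context (I : alphabetType) (R : realType) (p : I -> R).
Context (mu : probability (shift_space I) R).
Hypothesis muE : forall w, word_mass mu w = \prod_(i <- w) p i.
Let sh := @left_shift I.
Let mls := @measurable_left_shift I.

Let split_word n m (x : shift_space I) : n.-tuple I * m.-tuple I :=
  (word n x, word m (iter n sh x)).

Let finite_rv_split n m : finite_rv (split_word n m).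
Proof.
apply: finite_rv_pair; first exact: finite_rv_word.
exact: (finite_rv_iter mls n (@finite_rv_word I m)).
Qed.

Let mass_split n m u v : mass mu (split_word n m) (u, v) =
  (\prod_(i <- u) p i) * \prod_(i <- v) p i.
Proof.
rewrite -big_cat -muE -[u ++ v]/(tval (cat_tuple u v)) -mass_word.
rewrite /mass; congr (fine (mu _)).
have wD x : word (n + m) x = word n x ++ word m (iter n sh x) :> seq I.
  rewrite !val_word /mkseq iotaD map_cat; congr (_ ++ _).
  rewrite -[(0 + n)%N]/n -[n in iota n m]addn0 iotaDl -map_comp.
  by apply: eq_map => k /=; rewrite iter_left_shift addnC.
apply/seteqP; split=> x /=.
  by move=> [<- <-]; apply: val_inj; rewrite /= wD.
move=> xw.
have : word n x ++ word m (iter n sh x) == u ++ v by rewrite -wD xw.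
rewrite eqseq_cat ?size_tuple// => /andP[/eqP e1 /eqP e2].
by rewrite /split_word; congr pair; exact: val_inj.
Qed.

Let sum_prod n : \sum_(u : n.-tuple I) \prod_(i <- u) p i = 1.
Proof.
rewrite -[RHS](sum_mass mu (@finite_rv_word I n)).
by apply: eq_bigr => u _; rewrite mass_word muE.
Qed.

Lemma bernoulli_invariant : invariant_measure sh mu.
Proof.
have [nu nuE] := pushforward_probability mu mls.
suff same : same_measure nu mu by move=> B mB; rewrite -nuE same.
apply: same_measure_words => n w.
have -> : mass nu (@word I n) w = mass mu (snd \o split_word 1 n) w.
  by rewrite /mass nuE.
rewrite mass_comp// [RHS]mass_word muE -[RHS]mul1r -[X in _ = X * _](sum_prod
  1).
rewrite (eq_bigr (fun z : 1.-tuple I * n.-tuple I =>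
  (\prod_(i <- z.1) p i) * \prod_(i <- z.2) p i)); last first.
  by case=> u v _; exact: mass_split.
rewrite (eq_bigl (fun z => predT z.1 && (pred1 w) z.2))//.
rewrite -(pair_big predT (pred1 w)
  (fun (u : 1.-tuple I) (v : n.-tuple I) => (\prod_(i <- u) p i) * \prod_(i
    <- v) p i))/= mulr_suml.
by apply: eq_bigr => u _; rewrite big_pred1_eq.
Qed.

Lemma bernoulli_independent n m (S U : pred (seq I)) :
  fine (mu (cylinder n S `&` iter n sh @^-1` cylinder m U)) =
  fine (mu (cylinder n S)) * fine (mu (cylinder m U)).
Proof.
have -> : cylinder n S `&` iter n sh @^-1` cylinder m U =
    [set x | (fun z : n.-tuple I * m.-tuple I => S z.1 && U z.2)
      (split_word n m x)].
  apply/seteqP; split=> x; rewrite /cylinder/= !val_word.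
    by move=> [-> ->].
  by move=> /andP[].
rewrite (probability_finite_rv mu (fun z : n.-tuple I * m.-tuple I => S z.1
  && U z.2))//.
rewrite !cylinder_word.
rewrite (probability_finite_rv mu (fun w : n.-tuple I => S w)
  (@finite_rv_word I n)).
rewrite (probability_finite_rv mu (fun w : m.-tuple I => U w)
  (@finite_rv_word I m)).
rewrite big_distrlr/= (pair_big _ _ _)/=.
by apply: eq_bigr => -[u v] _; rewrite mass_split !mass_word !muE.
Qed.

Lemma bernoulli_ergodic k : ergodic (iter k.+1 sh) mu.
Proof.
apply: mixing_ergodic.
- exact: measurable_iter.
- exact: invariant_iter mls bernoulli_invariant k.+1.
(* The [n] iterates move by [n * k.+1 >= n] coordinates, past all those that the cylinder reads. *)
move=> n S; exists n.
have -> : iter n (iter k.+1 sh) = iter (n * k.+1) sh.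
  by elim: n => [|n IH] //; apply/funext => x; rewrite mulSn iterD -IH.
rewrite {1}(cylinder_widen S (_ : n <= n * k.+1)%N); last by rewrite leq_pmulr.
rewrite bernoulli_independent expr2 -(cylinder_widen S (_ : n <= n * k.+1)%N)//.
by rewrite leq_pmulr.
Qed.

End bernoulli_shift.

(** * Grouping into blocks as an isomorphism of shifts *)

Definition unblock (I : alphabetType) (n : nat) (y : shift_space (n.-tuple I)) :
    shift_space I :=
  fun k => nth point (y (k %/ n)%N) (k %% n).

Section unblock.
Context (I : alphabetType) (n : nat).
Hypothesis n0 : (0 < n)%N.

Lemma blockK : cancel (@block I n) (@unblock I n).
Proof.
move=> x; apply/funext => k; rewrite /unblock /block.
have kn : (k %% n < n)%N by rewrite ltn_mod.
rewrite -[(k %% n)%N]/(val (Ordinal kn)) -tnth_nth tnth_mktuple /=.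
by rewrite -divn_eq.
Qed.

Lemma unblockK : cancel (@unblock I n) (@block I n).
Proof.
move=> y; apply/funext => k; apply: eq_from_tnth => j.
rewrite /unblock /block tnth_mktuple divnMDl// divn_small// addn0.
by rewrite modnMDl modn_small// -tnth_nth.
Qed.

Lemma measurable_unblock : measurable_fun setT (@unblock I n).
Proof.
apply: measurable_to_shift => k.
exact: (finite_rv_comp (fun v : n.-tuple I =>
  nth point v (k %% n)) (finite_rv_coord (k %/ n)%N)).
Qed.

Lemma unblock_iter_shift m (y : shift_space (n.-tuple I)) :
  unblock (iter m (@left_shift _) y) = iter (m * n) (@left_shift I) (unblock y).
Proof.
elim: m => [//|m IH]; rewrite mulSn iterD -IH /= -{1}[iter m _ y]unblockK.
by rewrite -block_shift blockK.
Qed.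

Lemma preimage_block_unblock (B : set (shift_space I)) :
  @block I n @^-1` (@unblock I n @^-1` B) = B.
Proof. by apply/seteqP; split=> x /=; rewrite blockK. Qed.

Lemma measurable_unblock_preimage (B : set (shift_space I)) :
  measurable B -> measurable (@unblock I n @^-1` B).
Proof. by move=> mB; rewrite -[X in measurable X]setTI;
  exact: measurable_unblock. Qed.

Lemma measurable_block_preimage (C : set (shift_space (n.-tuple I))) :
  measurable C -> measurable (@block I n @^-1` C).
Proof. by move=> mC; rewrite -[X in measurable X]setTI;
  exact: measurable_block. Qed.

Section distribution_block.
Context (R : realType) (nu : probability (shift_space I) R).

Lemma invariant_distribution_block :
  invariant_measure (iter n (@left_shift I)) nu <->
  invariant_measure (@left_shift _) (distribution nu (@block I n)).
Proof.
have shiftE C : iter n (@left_shift I) @^-1` (@block I n @^-1` C) =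
    @block I n @^-1` (@left_shift _ @^-1` C).
  by apply/seteqP; split=> x /=; rewrite block_shift.
split=> inv B mB.
  rewrite /distribution /pushforward -[LHS]/(nu (@block I n @^-1`
    (@left_shift _ @^-1` B))).
  by rewrite -shiftE inv//; exact: measurable_block_preimage.
rewrite -[in LHS](preimage_block_unblock B) shiftE.
rewrite -[in RHS](preimage_block_unblock B).
exact: (inv _ (measurable_unblock_preimage mB)).
Qed.

Lemma word_mass_distribution_block (w : seq (n.-tuple I)) :
  word_mass (distribution nu (@block I n)) w =
  word_mass nu (flatten [seq val v | v <- w]).
Proof.
have flat x m : flatten [seq val v | v <- mkseq (@block I n x) m] = mkseq x
  (m * n).
  elim: m => [//|m IH]; rewrite mkseqS map_rcons flatten_rcons IH mulSn addnC.
  rewrite /mkseq iotaD map_cat add0n; congr (_ ++ _).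
  rewrite -[(m * n)%N in RHS]addn0 iotaDl -map_comp -val_enum_ord -map_comp.
  by [].
have sz (v : seq (n.-tuple I)) : shape [seq val u | u <- v] = nseq (size v) n.
  by elim: v => //= u v ->; rewrite size_tuple.
rewrite /word_mass; congr (fine _); rewrite /distribution /pushforward.
congr (nu _); rewrite size_flatten sz sumn_nseq mulnC.
apply/seteqP; split=> x; rewrite /cylinder/= -flat.
  by move=> /eqP ->.
(* Both lists of blocks have the same shape, so their concatenations determine them. *)
move=> /eqP e; apply/eqP; apply: (inj_map val_inj).
rewrite -[LHS]flattenK -[RHS]flattenK !sz e.
by rewrite size_mkseq.
Qed.

End distribution_block.
End unblock.

(** * The pair of matrices *)

Section example.
Context (R : realType).
Local Notation A := (@example_pair R).

(* [A b *m A a] sends the first basis vector to [pair_coef a b] times itself. *)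
Definition pair_coef (a b : 'I_2) : R := if a == b then 4 else 5.

(** The parameter [h] is the weight of an unpaired last letter: 1 in the norm estimates, and the
    marginal [2^-1] in the masses of [nu1]. *)
Fixpoint pair_weight (c : 'I_2 -> 'I_2 -> R) (h : R) (w : seq 'I_2) : R :=
  match w with
  | [::] => 1
  | [:: a] => h
  | a :: b :: w' => c a b * pair_weight c h w'
  end.

Lemma seq_ind2step (T : Type) (P : seq T -> Prop) :
  P [::] -> (forall a, P [:: a]) ->
  (forall a b w, P w -> P [:: a, b & w]) -> forall w, P w.
Proof.
move=> P0 P1 P2 w; suff: P w /\ forall a, P (a :: w) by case.
by elim: w => [|b w [IH1 IH2]]; split=> // a; exact: P2.
Qed.

Lemma pair_coef_ge1 a b : 1 <= pair_coef a b.
Proof. by rewrite /pair_coef; case: ifP => _; rewrite ler1n. Qed.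

Let ord3P (P : 'I_3 -> Prop) : P 0 -> P 1 -> P 2 -> forall i, P i.
Proof.
move=> P0 P1 P2 [[|[|[|//]]] ilt].
- by rewrite (_ : Ordinal ilt = 0)//; exact: val_inj.
- by rewrite (_ : Ordinal ilt = 1)//; exact: val_inj.
- by rewrite (_ : Ordinal ilt = 2)//; exact: val_inj.
Qed.

Let ord2P (P : 'I_2 -> Prop) : P 0 -> P 1 -> forall i, P i.
Proof.
move=> P0 P1 [[|[|//]] ilt].
- by rewrite (_ : Ordinal ilt = 0)//; exact: val_inj.
- by rewrite (_ : Ordinal ilt = 1)//; exact: val_inj.
Qed.

Lemma example_mul_col0 a b i :
  (A b *m A a) i 0 = if i == 0 then pair_coef a b else 0.
Proof.
rewrite mxE !big_ord_recl big_ord0 /pair_coef.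
elim/ord2P: a; elim/ord2P: b; elim/ord3P: i;
  rewrite /example_pair /= !mxE /=; ring.
Qed.

Lemma example_block_zero a k j : k != 0 -> j != 0 -> A a k j = 0.
Proof.
by elim/ord2P: a; elim/ord3P: k; elim/ord3P: j;
  rewrite // /example_pair /= !mxE.
Qed.

Lemma example_row0 a j : j != 0 -> 1 <= A a 0 j <= 2.
Proof.
by elim/ord2P: a; elim/ord3P: j; rewrite // /example_pair /= !mxE /= ?lexx
  ?ler1n.
Qed.

Lemma example_col0 a i : 0 <= A a i 0 <= 2.
Proof.
elim/ord2P: a; elim/ord3P: i; rewrite /example_pair /= !mxE /=;
  apply/andP; split; lra.
Qed.

Lemma word_product_cons2 a b w :
  word_product A [:: a, b & w] = word_product A w *m (A b *m A a).
Proof.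
by rewrite -[[:: a, b & w]]/([:: a; b] ++ w) word_product_cat /word_product
  /= mulmx1.
Qed.

(** A basis vector of [V2] is sent into [V1] by the first letter, so the pairing starts at the
    second one; this is the origin of [behead] in the norm estimates. *)
Lemma example_cons_col a w i j : j != 0 ->
  word_product A (a :: w) i j = word_product A w i 0 * A a 0 j.
Proof.
move=> j0; rewrite -[a :: w]/([:: a] ++ w) word_product_cat
  {2}/word_product/= mulmx1.
rewrite mxE (bigD1 0)//= big1 ?addr0// => k k0.
by rewrite (example_block_zero a k0 j0) mulr0.
Qed.

(** Each pair multiplies the first basis vector by its coefficient; an unpaired last letter then
    gives a vector with entries 0, 1 and 2, whence the factor 2 and the unspecified row in the lower
    bound. *)
Lemma word_product_col0 w :
  (forall i, 0 <= word_product A w i 0 <= 2 * pair_weight pair_coef 1 w) /\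
  exists i, pair_weight pair_coef 1 w <= word_product A w i 0.
Proof.
elim/seq_ind2step: w => [|a|a b w [IH1 [i IH2]]].
- split; last by exists 0; rewrite /word_product/= mxE.
  by move=> i; rewrite /word_product /= mxE; case: (i == 0) => /=; lra.
- rewrite /word_product /= mulmx1; split; first by move=> i;
    rewrite mulr1 example_col0.
  by exists 1; elim/ord2P: a; rewrite /example_pair /= !mxE /= ?ler1n.
have colE k : word_product A [:: a, b & w] k 0 = pair_coef a b * word_product
  A w k 0.
  rewrite word_product_cons2 mxE (bigD1 0)//= big1 ?addr0.
    by rewrite example_mul_col0 eqxx mulrC.
  by move=> l /negPf l0; rewrite example_mul_col0 l0 mulr0.
have c0 : 0 <= pair_coef a b by exact: le_trans ler01 (pair_coef_ge1 a b).
split; last by exists i; rewrite colE /= ler_wpM2l.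
move=> k; rewrite colE /= mulr_ge0 ?(andP (IH1 k)).1//=.
by rewrite mulrCA ler_wpM2l// (andP (IH1 k)).2.
Qed.

Lemma pair_weight_ge1 w : 1 <= pair_weight pair_coef 1 w.
Proof.
elim/seq_ind2step: w => //= a b w IH.
by apply: mulr_ege1 => //; exact: pair_coef_ge1.
Qed.

Lemma example_norm_ge w :
  Num.max (pair_weight pair_coef 1 w) (pair_weight pair_coef 1 (behead w)) <=
  operator_norm (word_product A w).
Proof.
have [_ [i wi]] := word_product_col0 w.
rewrite ge_max; apply/andP; split.
  by rewrite (le_trans wi)// (le_trans (ler_norm _))//
    norm_entry_le_operator_norm.
case: w {i wi} => [|a w] /=.
  apply: le_trans (norm_entry_le_operator_norm _ 0 0).
  by rewrite /word_product/= mxE normr1.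
have [_ [i wi]] := word_product_col0 w.
apply: le_trans (norm_entry_le_operator_norm _ i 1).
rewrite example_cons_col// (le_trans wi)// (le_trans _ (ler_norm _))//.
have /andP[a1 _] := @example_row0 a 1 isT.
by rewrite ler_peMr// (le_trans _ wi)// (le_trans ler01)// pair_weight_ge1.
Qed.

Lemma example_norm_ge1 w : 1 <= operator_norm (word_product A w).
Proof.
apply: le_trans (example_norm_ge w).
by rewrite le_max pair_weight_ge1.
Qed.

Lemma example_norm_le w : operator_norm (word_product A w) <=
  36 * Num.max (pair_weight pair_coef 1 w) (pair_weight pair_coef 1 (behead w)).
Proof.
set m := Num.max _ _.
have wm : pair_weight pair_coef 1 w <= m by rewrite le_max lexx.
have bm : pair_weight pair_coef 1 (behead w) <= m by rewrite le_max lexx orbT.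
(* Nine entries bounded by [4 * m] give 36. In the 4, one factor 2 comes from [word_product_col0]
   and the other from the first row of the first letter. *)
suff le4 i j : `|word_product A w i j| <= 4 * m.
  apply: le_trans (operator_norm_le_sum _) _.
  apply: (@le_trans _ _ (\sum_(i < 3) \sum_(j < 3) (4 * m))).
    by apply: ler_sum => i _; exact: ler_sum.
  by rewrite !sumr_const !card_ord -!mulrnA -mulr_natl; lra.
have m1 : 1 <= m by apply: le_trans (pair_weight_ge1 w) wm.
have [->|j0] := eqVneq j 0.
  have [/(_ i)/andP[w0 w2] _] := word_product_col0 w.
  by rewrite ger0_norm//; lra.
case: w @m wm bm m1 => [|a w] m wm bm m1.
  by rewrite /word_product/= mxE; case: (i == j); rewrite /= ?normr1 ?normr0;
    lra.
rewrite example_cons_col//; have [/(_ i)/andP[w0 w2] _] := word_product_col0 w.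
have /andP[a1 a2] := example_row0 a j0.
have a0 : 0 <= A a 0 j by exact: le_trans ler01 a1.
rewrite ger0_norm ?mulr_ge0//.
apply: le_trans (ler_pM w0 a0 w2 a2) _; rewrite /= in bm; lra.
Qed.

Let vec3 (x y z : R) : 'cV[R]_3 := \col_i nth 0 [:: x; y; z] i.

Let example_vec3 x y z :
  A 0 *m vec3 x y z = vec3 (y + 2 * z) (2 * x) x /\
  A 1 *m vec3 x y z = vec3 (2 * y + z) x (2 * x).
Proof.
by split; apply/matrixP => i j; rewrite ord1 !mxE !big_ord_recl big_ord0;
  elim/ord3P: i; rewrite /example_pair /= !mxE /=; ring.
Qed.

Let lin_vec3 a b x y z x' y' z' : a *: vec3 x y z + b *: vec3 x' y' z' =
  vec3 (a * x + b * x') (a * y + b * y') (a * z + b * z').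
Proof. by apply/matrixP => i j; rewrite !mxE; elim/ord3P: i. Qed.

(** The images of the first basis vector, [(0, 2, 1)] and [(0, 1, 2)], span [V2], so it suffices to
    extract a nonzero multiple of this vector from any nonzero element of [U]. *)
Lemma example_irreducible : irreducible_tuple A.
Proof.
move=> U inv; have [U0|U0] := eqVneq U 0%VS; [by left|right].
have invc x y z : vec3 x y z \in U ->
    vec3 (y + 2 * z) (2 * x) x \in U /\ vec3 (2 * y + z) x (2 * x) \in U.
  by move=> vU; have [<- <-] := example_vec3 x y z; split; exact: inv.
have linc a b x y z x' y' z' : vec3 x y z \in U -> vec3 x' y' z' \in U ->
    vec3 (a * x + b * x') (a * y + b * y') (a * z + b * z') \in U.
  by move=> vU vU'; rewrite -lin_vec3 rpredD// rpredZ.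
have vecE (v : 'cV[R]_3) : v = vec3 (v 0 0) (v 1 0) (v 2 0).
  by apply/matrixP => i j; rewrite ord1 !mxE; elim/ord3P: i.
suff [t t0 tU] : exists2 t, t != 0 & vec3 t 0 0 \in U.
  apply/eqP; rewrite eqEsubv subvf; apply/subvP => v _; rewrite (vecE v).
  move: (v 0 0) (v 1 0) (v 2 0) => x y z.
  have [u1 u2] := invc _ _ _ tU.
  (* These coefficients solve the 2 by 2 system that writes [(0, y, z)] in terms of [t (0, 2, 1)]
     and [t (0, 1, 2)]. *)
  have := linc ((2 * y - z) / (3 * t)) ((2 * z - y) /
    (3 * t)) _ _ _ _ _ _ u1 u2.
  move=> /(linc (x / t) 1 _ _ _ _ _ _ tU).
  by congr (vec3 _ _ _ \in U); field.
have vU := memv_pick U; have v0 : vpick U != 0 by rewrite vpick0.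
move: vU v0; rewrite [vpick U]vecE.
move: (vpick U 0 0) (vpick U 1 0) (vpick U 2 0) => a b c vU v0.
have [v1 v2] := invc _ _ _ vU.
have [v11 v21] := invc _ _ _ v1; have [v12 v22] := invc _ _ _ v2.
(* A vector of [V2] is sent into [V1] by both matrices, and only the zero vector is killed by
   both. *)
have [a0|a0] := eqVneq a 0.
  have [b1|b1] := eqVneq (b + 2 * c) 0; last first.
    by exists (b + 2 * c) => //; move: v1; rewrite a0 mulr0.
  have [b2|b2] := eqVneq (2 * b + c) 0; last first.
    by exists (2 * b + c) => //; move: v2; rewrite a0 mulr0.
  have b0 : b = 0 by lra.
  have c0 : c = 0 by lra.
  case/eqP: v0; apply/matrixP => i j; rewrite !mxE a0 b0 c0.
  by elim/ord3P: i.
(* Two products of length 2 with the same last matrix send the vector to images with proportional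
   [V2] parts. Eliminating these parts leaves [a * d1], or [a * d2] for the other last matrix, times
   the first basis vector. The forms [d1] and [d2] vanish together only if [b = c = 0]. *)
pose d1 := 4 * (2 * b + c) - 5 * (b + 2 * c).
pose d2 := 5 * (2 * b + c) - 4 * (b + 2 * c).
have [d10|d10] := eqVneq d1 0; last first.
  exists (a * d1); first by rewrite mulf_neq0.
  have := linc (2 * b + c) (- (b + 2 * c)) _ _ _ _ _ _ v11 v12.
  by congr (vec3 _ _ _ \in U); rewrite /d1; ring.
have [d20|d20] := eqVneq d2 0; last first.
  exists (a * d2); first by rewrite mulf_neq0.
  have := linc (2 * b + c) (- (b + 2 * c)) _ _ _ _ _ _ v21 v22.
  by congr (vec3 _ _ _ \in U); rewrite /d2; ring.
have b0 : b = 0 by move: d10 d20; rewrite /d1 /d2; lra.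
have c0 : c = 0 by move: d10 d20; rewrite /d1 /d2; lra.
by exists a => //; rewrite -[X in vec3 a X _]b0 -[X in vec3 a _ X]c0.
Qed.

End example.

Lemma total_probability d (T : measurableType d) (R : realType)
    (mu : probability T R) (J : finType) (X : T -> J) (B : set T) :
  finite_rv X -> measurable B ->
  fine (mu B) = \sum_j fine (mu (X @^-1` [set j] `&` B)).
Proof.
move=> mX mB; pose Y x : bool := `[< B x >].
have YE : Y @^-1` [set true] = B.
  by apply/seteqP; split=> x /=; rewrite /Y; [move/asboolP|move=> Bx;
    apply/asboolP].
have mY : finite_rv Y.
  case; first by rewrite YE.
  rewrite (_ : _ @^-1` _ = ~` B); first exact: measurableC.
  apply/seteqP; split=> x /=; rewrite /Y; first by move/negbT/asboolPn.
  exact: asboolF.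
have mZ := finite_rv_pair mX mY.
have -> : fine (mu B) = mass mu (snd \o (fun x => (X x, Y x))) true.
  by rewrite /mass -{1}YE.
rewrite mass_comp// (eq_bigl (fun z : J * bool =>
  predT z.1 && (pred1 true) z.2))//.
rewrite (eq_bigr (fun z : J * bool => mass mu (fun x => (X x, Y x))
  (z.1, z.2))); last by case.
rewrite -(pair_big predT (pred1 true) (fun j b =>
  mass mu (fun x => (X x, Y x)) (j, b)))/=.
apply: eq_bigr => j _; rewrite big_pred1_eq /mass; congr (fine (mu _)).
by rewrite -YE; apply/seteqP; split=> x /= [-> ->].
Qed.

Lemma sum_2tuple (R : realType) (J : finType) (F : 2.-tuple J -> R) :
  \sum_v F v = \sum_a \sum_b F [tuple a; b].
Proof.
rewrite pair_big/= (reindex (fun z : J * J => [tuple z.1; z.2]))//=.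
exists (fun v : 2.-tuple J => (tnth v ord0, tnth v ord_max)) =>
  [[a b] _|v _] //=.
by case: v => [[|a [|b [|//]]] sv] //; exact: val_inj.
Qed.

Lemma word_product_block_tuple (R : realType) d (I : alphabetType)
    (A : I -> 'M[R]_d) n (W : seq (n.-tuple I)) :
  word_product (@block_tuple R d I A n) W =
  word_product A (flatten [seq val v | v <- W]).
Proof.
elim: W => [//|v W IH]; rewrite -[v :: W]/([:: v] ++ W) word_product_cat IH.
by rewrite /= word_product_cat {2}/word_product /= mulmx1.
Qed.

Lemma equilibrium_stateP (R : realType) d (I : alphabetType) (A : I -> 'M[R]_d)
    (s P : R) (nu0 : probability (shift_space I) R) :
  (forall nu, invariant_measure (@left_shift I) nu ->
    (free_energy A s nu <= P%:E)%E) ->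
  invariant_measure (@left_shift I) nu0 -> (P%:E <= free_energy A s nu0)%E ->
  forall nu, equilibrium_state A s nu <->
    invariant_measure (@left_shift I) nu /\ free_energy A s nu = P%:E.
Proof.
move=> le inv0 ge nu.
have supE : ereal_sup [set free_energy A s nu |
    nu in [set nu | invariant_measure (@left_shift I) nu]] = P%:E.
  apply/eqP; rewrite eq_le; apply/andP; split.
    by apply: ge_ereal_sup => _ [nu' inv' <-]; exact: le.
  by apply: le_trans ge _; apply: ereal_sup_ubound; exists nu0.
by rewrite /equilibrium_state supE.
Qed.

(** * Gibbs bounds and equilibrium states of the pair *)

Section equilibrium_states.
Context (R : realType) (s : R).
Hypothesis s0 : 0 < s.
Local Notation A := (@example_pair R).
Local Notation sh := (@left_shift 'I_2).
Let mls := @measurable_left_shift 'I_2.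

(** [Z] normalizes the weights of the four pairs, two with coefficient 4 and two with coefficient 5.
    A pair covers two letters, hence the division by 2 in [P]. *)
Let Z : R := 2 * (4 `^ s + 5 `^ s).
Let P : R := ln Z / 2.
Let p (a b : 'I_2) : R := pair_coef R a b `^ s / Z.
Let E := pair_weight (pair_coef R) 1.
Let g := pair_weight p 2^-1.

Let pow0 (a : R) : 0 < a -> 0 < a `^ s. Proof. exact: powR_gt0. Qed.

Let Z0 : 0 < Z.
Proof. by rewrite mulr_gt0// addr_gt0// pow0. Qed.

Let coef0 a b : 0 < pair_coef R a b.
Proof. exact: lt_le_trans ltr01 (pair_coef_ge1 R a b). Qed.

Let p0 a b : 0 < p a b.
Proof. by rewrite divr_gt0// pow0. Qed.

Let sum_coef_r a : \sum_b pair_coef R a b `^ s = 4 `^ s + 5 `^ s.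
Proof.
by rewrite !big_ord_recl big_ord0 addr0 /pair_coef;
  case: a => [[|[|//]] ilt] //=;
  rewrite addrC.
Qed.

Let sum_pr a : \sum_b p a b = 2^-1.
Proof.
by rewrite -mulr_suml sum_coef_r /Z invfM mulrCA divff ?mulr1// gt_eqF//
  addr_gt0 ?pow0.
Qed.

Let pC a b : p a b = p b a.
Proof. by rewrite /p /pair_coef eq_sym. Qed.

Let sum_pl b : \sum_a p a b = 2^-1.
Proof. by rewrite -(sum_pr b); apply: eq_bigr => a _; rewrite pC. Qed.

Let q (v : 2.-tuple 'I_2) : R := p (tnth v ord0) (tnth v ord_max).

Let sum_q : \sum_v q v = 1.
Proof.
rewrite sum_2tuple (eq_bigr (fun=> 2^-1)); last by move=> a _; exact: sum_pr.
by rewrite sumr_const card_ord -[LHS]mulr_natl mulfV.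
Qed.

Let E0 w : 0 < E w.
Proof. exact: lt_le_trans ltr01 (pair_weight_ge1 R w). Qed.

Let g0 w : 0 < g w.
Proof.
elim/seq_ind2step: w => [|a|a b w IH]; rewrite /g /= ?invr_gt0//.
by rewrite mulr_gt0// p0.
Qed.

Let gS a b w : g [:: a, b & w] = p a b * g w. Proof. by []. Qed.

Let ES a b w : E [:: a, b & w] = pair_coef R a b * E w. Proof. by []. Qed.

(** A pair contributes exactly [s * ln c - 2 * P]. The parity term corrects for an unpaired last
    letter, whose mass is [2^-1] and not [expR (- P)]. *)
Let ln_g w : ln (g w) =
  s * ln (E w) - (size w)%:R * P + (odd (size w))%:R * (P - ln 2).
Proof.
elim/seq_ind2step: w => [|a|a b w IH].
- by rewrite /g /E /= ln1; ring.
- by rewrite /g /E /= ln1 lnV ?posrE//; ring.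
rewrite gS ES /= negbK !lnM ?posrE ?E0 ?g0 ?p0 ?coef0 ?pow0 ?invr_gt0// IH.
by rewrite lnV ?posrE// ln_powR -[(size w).+2]addn2 natrD /P; field.
Qed.

Section masses.
Context (beta : probability (shift_space (2.-tuple 'I_2)) R).
Hypothesis betaE : forall w, word_mass beta w = \prod_(i <- w) q i.
Context (nu1 nu2 : probability (shift_space 'I_2) R).
Hypotheses (nu1E : forall B, nu1 B = beta (@unblock 'I_2 2 @^-1` B))
  (nu2E : forall B, nu2 B = nu1 (sh @^-1` B)).

Let mkseqSS (x : shift_space 'I_2) k :
  mkseq x k.+2 = [:: x 0%N, x 1%N & mkseq (iter 2 sh x) k].
Proof.
by rewrite /mkseq /= (iotaDl 2 0) -map_comp.
Qed.

Lemma word_mass_nu1 w : word_mass nu1 w = g w.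
Proof.
have half0 : (0 < 2)%N by [].
elim/seq_ind2step: w => [|a|a b w IH].
- rewrite /word_mass nu1E (_ : _ @^-1` _ = setT) ?probability_setT//.
  by apply/seteqP; split.
- rewrite /word_mass nu1E.
  have -> : @unblock 'I_2 2 @^-1` cylinder (size [:: a]) (pred1 [:: a]) =
      [set y | (fun v : 2.-tuple 'I_2 => tnth v ord0 == a) (y 0%N)].
    apply/seteqP; split=> y; rewrite /cylinder/= /mkseq /= /unblock /=
      eqseq_cons andbT;
    by rewrite -[nth point _ 0]/(nth point (y 0%N) (val (@ord0 1))) -tnth_nth.
  rewrite (probability_finite_rv beta (fun v : 2.-tuple 'I_2 =>
    tnth v ord0 == a) (finite_rv_coord 0)).
  rewrite (eq_bigr q); last first.
    move=> v _; transitivity (word_mass beta [:: v]);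
      last by rewrite betaE big_seq1.
    rewrite /mass /word_mass; congr (fine (beta _)).
    apply/seteqP; split=> y; rewrite /cylinder/= /mkseq/= eqseq_cons andbT.
      by move=> ->.
    by move=> /eqP.
  rewrite big_mkcond/= sum_2tuple (bigD1 a)//= [X in _ + X]big1 ?addr0.
    by rewrite /g /= -(sum_pr a); apply: eq_bigr => b _;
      rewrite (tnth_nth a) /= eqxx.
  by move=> c /negPf ca; rewrite big1// => b _; rewrite ca.
rewrite gS -IH.
(* Reading [size w] blocks is more than enough to see [size w] letters; all that matters is that the
   preimage is a cylinder, to which independence from the first block applies. *)
pose S (u : seq (2.-tuple 'I_2)) :=
  all (fun i => nth point (nth point u (i %/ 2)) (i %% 2) == nth point w i)
    (iota 0 (size w)).
have SE : @unblock 'I_2 2 @^-1` cylinder (size w) (pred1 w) = cylinder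
  (size w) S.
  apply/seteqP; split=> y; rewrite /cylinder/= => yw.
    apply/allP => i; rewrite mem_iota add0n => /= iw.
    have e := congr1 (nth point ^~ i) (eqP yw); rewrite /= nth_mkseq// in e.
    have i2 : (i %/ 2 < size w)%N := leq_ltn_trans (leq_div i 2) iw.
    by rewrite (nth_mkseq point y i2) -[X in X == _]/(unblock y i) e.
  apply/eqP/(@eq_from_nth _ point); rewrite size_mkseq// => i iw.
  rewrite nth_mkseq//; have /allP/(_ i) := yw.
  rewrite mem_iota add0n /= iw => /(_ isT)/eqP <-.
  have i2 : (i %/ 2 < size w)%N := leq_ltn_trans (leq_div i 2) iw.
  by rewrite (nth_mkseq point y i2).
have -> : p a b = word_mass beta [:: [tuple a; b]] by rewrite betaE big_seq1.
rewrite [in RHS]/word_mass nu1E SE -(bernoulli_independent betaE).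
rewrite /word_mass nu1E -SE; congr (fine (beta _)).
apply/seteqP; split=> y; rewrite /cylinder [size _]/= /=.
  rewrite mkseqSS -(unblock_iter_shift half0 1) !eqseq_cons => /and3P[/eqP ya
    /eqP yb yw].
  split; last exact: yw.
  suff y0 : y 0%N = [tuple a; b] by apply/andP; split=> //; exact/eqP.
  apply: eq_from_tnth => i; rewrite !(tnth_nth point).
  by case: i => [[|[|//]] ilt] /=; rewrite -?ya -?yb.
move=> [/eqP/(congr1 (head point)) y0 yw]; rewrite /= in y0.
rewrite mkseqSS -(unblock_iter_shift half0 1).
rewrite !eqseq_cons yw andbT /unblock /= y0.
by apply/andP; split; exact: eqxx.
Qed.

(** Sum over the letter that precedes [b]: it pairs with [b], and the columns of [p] sum to
    [2^-1]. *)
Lemma word_mass_nu2 b w : word_mass nu2 (b :: w) = g w / 2.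
Proof.
have mC := measurable_cylinder (size (b :: w)) (pred1 (b :: w)).
rewrite /word_mass nu2E (total_probability nu1 (finite_rv_coord 0)); last first.
  by rewrite -[X in measurable X]setTI; exact: mls.
rewrite (eq_bigr (fun a => p a b * g w)); first by rewrite -mulr_suml sum_pl
  mulrC.
move=> a _; rewrite -[RHS]/(g [:: a, b & w]) -word_mass_nu1 /word_mass.
congr (fine (nu1 _)).
have mkseqS' (x : shift_space 'I_2) k : mkseq x k.+1 = x 0%N :: mkseq (sh x) k.
  by rewrite /mkseq /= (iotaDl 1 0) -map_comp.
apply/seteqP; split=> x; rewrite /cylinder/preimage /=.
  by move=> [<- /eqP xw]; rewrite mkseqS' xw.
by rewrite mkseqS' eqseq_cons => /andP[/eqP <- ->].
Qed.

Lemma word_mass_nu2_nil : word_mass nu2 [::] = 1.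
Proof.
rewrite /word_mass (_ : cylinder _ _ = setT) ?probability_setT//.
by apply/seteqP; split.
Qed.

Context (mu : probability (shift_space 'I_2) R).
Hypothesis muE : forall B, mu B = (2^-1%:E * (nu1 B + nu2 B))%E.

Lemma word_mass_mu w : word_mass mu w = (word_mass nu1 w + word_mass nu2 w) / 2.
Proof.
have mC := measurable_cylinder (size w) (pred1 w).
apply: EFin_inj; rewrite /word_mass probability_fineK// muE mulrC EFinM EFinD.
by rewrite !probability_fineK.
Qed.

Let nu2_gt0 w : 0 < word_mass nu2 w.
Proof.
by case: w => [|b w]; rewrite ?word_mass_nu2_nil// word_mass_nu2 divr_gt0 ?g0.
Qed.

Lemma word_mass_mu_gt0 w : 0 < word_mass mu w.
Proof. by rewrite word_mass_mu divr_gt0// addr_gt0 ?nu2_gt0// word_mass_nu1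
  g0. Qed.

(** [|P - ln 2|] absorbs the parity term of [ln_g] and [|P|] the letter removed by [behead]. In [K],
    [ln 36] is the norm comparison, one [ln 2] the factor 1/2 in the masses of [nu2], the other the
    factor 1/2 of the average. *)
Let K0 : R := `|P| + `|P - ln 2|.
Let K : R := s * ln 36 + 2 * ln 2 + K0.

Let ln2_gt0 : 0 < ln 2 :> R. Proof. by rewrite ln_gt0// ltr1n. Qed.

Let ln36_gt0 : 0 < s * ln 36 :> R.
Proof. by rewrite mulr_gt0// ln_gt0// ltr1n. Qed.

Let odd_le (w : seq 'I_2) :
  - `|P - ln 2| <= (odd (size w))%:R * (P - ln 2) <= `|P - ln 2|.
Proof.
case: (odd _); rewrite ?mul1r ?mul0r ?oppr_le0 ?normr_ge0//.
by rewrite ler_norm lerNl -normrN ler_norm.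
Qed.

Let ln_nu1 w :
  s * ln (E w) <= `|P - ln 2| + (size w)%:R * P + ln (word_mass nu1 w) /\
  (size w)%:R * P + ln (word_mass nu1 w) <= `|P - ln 2| + s * ln (E w).
Proof.
rewrite word_mass_nu1 ln_g; have /andP[] := odd_le w.
by move: (_ * (P - _)) (_%:R * P) => x y; lra.
Qed.

Let ln_nu2 w :
  s * ln (E (behead w)) <=
    K0 + ln 2 + (size w)%:R * P + ln (word_mass nu2 w) /\
  (size w)%:R * P + ln (word_mass nu2 w) <= K0 + s * ln (E (behead w)).
Proof.
have K00 : 0 <= K0 by rewrite addr_ge0.
case: w => [|b w] /=.
  by rewrite word_mass_nu2_nil ln1; have := ln2_gt0; lra.
rewrite word_mass_nu2 ln_div ?posrE ?g0// ln_g; have /andP[] := odd_le w.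
have := ler_norm P; have := ler_norm (- P); rewrite normrN /K0.
rewrite -[(size w).+1]addn1 natrD mulrDl mul1r; have := ln2_gt0.
by move: (_ * (P - _)) (_%:R * P) => x y; lra.
Qed.

Lemma example_upper w :
  s * ln (operator_norm (word_product A w)) <=
  K + (size w)%:R * P + ln (word_mass mu w).
Proof.
set m := Num.max (E w) (E (behead w)).
have m0 : 0 < m by rewrite lt_max E0.
have : s * ln (operator_norm (word_product A w)) <= s * ln 36 + s * ln m.
  rewrite -mulrDr ler_wpM2l ?(ltW s0)// -lnM ?posrE// ler_ln ?posrE.
  - exact: example_norm_le.
  - exact: lt_le_trans ltr01 (example_norm_ge1 R w).
  - by rewrite mulr_gt0.
have le1 : ln (word_mass nu1 w) <= ln 2 + ln (word_mass mu w).
  rewrite -lnM ?posrE ?word_mass_mu_gt0// ler_ln ?posrE ?mulr_gt0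
    ?word_mass_mu_gt0 ?word_mass_nu1//.
  by rewrite word_mass_mu -word_mass_nu1 mulrCA mulfV// mulr1 lerDl ltW.
have le2 : ln (word_mass nu2 w) <= ln 2 + ln (word_mass mu w).
  rewrite -lnM ?posrE ?word_mass_mu_gt0// ler_ln ?posrE ?mulr_gt0
    ?word_mass_mu_gt0 ?nu2_gt0//.
  by rewrite word_mass_mu mulrCA mulfV// mulr1 lerDr word_mass_nu1 ltW.
have [l1 _] := ln_nu1 w; have [l2 _] := ln_nu2 w.
have : s * ln m <= K0 + 2 * ln 2 + (size w)%:R * P + ln (word_mass mu w).
  have := normr_ge0 P; have := ln2_gt0; move: l1 l2 le1 le2;
    rewrite /K0 /m /Num.max.
  by case: ifP => _; lra.
by rewrite /K; lra.
Qed.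

Let norm_ge w : s * ln (E w) <= s * ln (operator_norm (word_product A w)) /\
  s * ln (E (behead w)) <= s * ln (operator_norm (word_product A w)).
Proof.
have := example_norm_ge R w; rewrite ge_max => /andP[n1 n2].
have n0 : 0 < operator_norm (word_product A w).
  exact: lt_le_trans ltr01 (example_norm_ge1 R w).
by split; rewrite ler_wpM2l ?(ltW s0)// ler_ln ?posrE ?E0.
Qed.

Lemma example_lower1 w : (size w)%:R * P + ln (word_mass nu1 w) <=
  K + s * ln (operator_norm (word_product A w)).
Proof.
have [_ l1] := ln_nu1 w; have [n1 _] := norm_ge w.
by have := normr_ge0 P; have := ln2_gt0; have := ln36_gt0; rewrite /K /K0; lra.
Qed.

Lemma example_lower2 w : (size w)%:R * P + ln (word_mass nu2 w) <=
  K + s * ln (operator_norm (word_product A w)).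
Proof.
have [_ l1] := ln_nu2 w; have [_ n1] := norm_ge w.
by have := ln2_gt0; have := ln36_gt0; rewrite /K; lra.
Qed.

(** An average is at most the larger of its two terms, and each term satisfies the bound. *)
Lemma example_lower_mu w : (size w)%:R * P + ln (word_mass mu w) <=
  K + s * ln (operator_norm (word_product A w)).
Proof.
have n1 : 0 < word_mass nu1 w by rewrite word_mass_nu1.
have n2 := nu2_gt0 w; have n := word_mass_mu_gt0 w.
have muE' := word_mass_mu w.
have [le|/ltW le] := leP (word_mass nu1 w) (word_mass nu2 w).
  apply: le_trans (example_lower2 w); rewrite lerD2l ler_ln ?posrE//; lra.
by apply: le_trans (example_lower1 w); rewrite lerD2l ler_ln ?posrE//; lra.
Qed.

Let nu1_invariant : invariant_measure (iter 2 sh) nu1.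
Proof.
move=> B mB; rewrite !nu1E -[RHS](bernoulli_invariant betaE); last first.
  exact: measurable_unblock_preimage.
congr (beta _); apply/funext => y.
have e : B (iter 2 sh (unblock y)) = B (unblock (left_shift y)).
  by rewrite -(unblock_iter_shift (n := 2) isT 1 y).
exact: e.
Qed.

Let nu1_ergodic k : ergodic (iter (k.+1 * 2) sh) nu1.
Proof.
move=> B mB fB; rewrite nu1E.
apply: (bernoulli_ergodic betaE (k := k)); first exact:
  measurable_unblock_preimage.
apply/funext => y.
exact: etrans (congr1 B (unblock_iter_shift (n := 2) isT k.+1 y))
  (congr1 (@^~ (unblock y)) fB).
Qed.

Let measurable_shift_preimage (B : set (shift_space 'I_2)) :
  measurable B -> measurable (sh @^-1` B).
Proof. by move=> mB; rewrite -[X in measurable X]setTI; exact: mls. Qed.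

Let nu2_invariant : invariant_measure (iter 2 sh) nu2.
Proof.
by move=> B mB; rewrite !nu2E -[RHS]nu1_invariant//;
  exact: measurable_shift_preimage.
Qed.

Let nu2_ergodic k : ergodic (iter (k.+1 * 2) sh) nu2.
Proof.
move=> B mB fB; rewrite nu2E; apply: (nu1_ergodic (k := k)).
  exact: measurable_shift_preimage.
apply/funext => x.
exact: etrans (congr1 B (iterSr (k.+1 * 2) sh x)) (congr1 (@^~ (sh x)) fB).
Qed.

(** The shift exchanges [nu1] and [nu2], because [nu1] is invariant under its square. *)
Let mu_invariant : invariant_measure sh mu.
Proof.
move=> B mB; rewrite !muE -[nu1 (sh @^-1` B)]nu2E [nu2 (sh @^-1` B)]nu2E.
by rewrite -[nu1 B](nu1_invariant mB) addeC.
Qed.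

(** Three is odd, so the third iterate exchanges [nu1] and [nu2], and they agree on [B]. Moreover
    [B] is invariant under the sixth iterate, an even one, for which [nu1] is ergodic. *)
Let mu_ergodic3 : ergodic (iter 3 sh) mu.
Proof.
move=> B mB fB.
have fBx x : B (iter 3 sh x) = B x := congr1 (@^~ x) fB.
have e : nu2 B = nu1 B.
  by rewrite -[in RHS]fB -(nu2_invariant mB) nu2E.
have fB6 : iter (3 * 2) sh @^-1` B = B.
  by apply/funext => x; exact: etrans (fBx (iter 3 sh x)) (fBx x).
rewrite muE e; have [->|->] := nu1_ergodic (k := 2) mB fB6.
  by left; rewrite adde0 mule0.
right; rewrite -EFinD -EFinM; congr (_%:E).
by rewrite -[1 + 1]/(2 : R) mulVf.
Qed.

Let mu_ergodic : ergodic sh mu.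
Proof.
move=> B mB fB; apply: mu_ergodic3 => //.
have fBx x : B (sh x) = B x := congr1 (@^~ x) fB.
by apply/funext => x; rewrite -[LHS]/(B (sh (sh (sh x)))) !fBx.
Qed.

(** The word made of two equal letters has mass [4 ^ s / Z] for [nu1] and 1/4 for [nu2]; equality
    would force [4 ^ s = 5 ^ s]. *)
Let nu1_neq_nu2 : ~ same_measure nu1 nu2.
Proof.
move=> same; have : word_mass nu1 [:: ord0; ord0] = word_mass nu2 [:: ord0;
  ord0].
  by rewrite /word_mass same//; exact: measurable_cylinder.
rewrite word_mass_nu1 word_mass_nu2 /g /= mulr1 /p /pair_coef eqxx.
have : 4 `^ s < 5 `^ s :> R by rewrite gt0_ltr_powR ?nnegrE// ltr_nat.
have := Z0; rewrite /Z; move: (4 `^ s) (5 `^ s) => x y z0 xy.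
move=> /(congr1 ( *%R^~ (2 * (x + y)))); rewrite divfK ?gt_eqF//; lra.
Qed.

(** An invariant set that separates [nu1] from [nu2] has [mu]-measure 1/2. *)
Let not_mu_ergodic2 : ~ ergodic (iter 2 sh) mu.
Proof.
move=> erg.
have m2 : measurable_fun setT (iter 2 sh) by exact: measurable_iter.
have [D [mD fD n1 n2]] := ergodic_separation m2 nu1_invariant nu2_invariant
  (nu1_ergodic (k := 0)) (nu2_ergodic (k := 0)) nu1_neq_nu2.
have := muE D; rewrite n1 n2 add0e mule1.
by have [->|->] := erg D mD fD => -[]; lra.
Qed.

Let mu_gt0 n (w : n.-tuple 'I_2) : 0 < mass mu (@word 'I_2 n) w.
Proof. by rewrite mass_word word_mass_mu_gt0. Qed.

Let mu_upper n (w : n.-tuple 'I_2) :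
  s * ln (operator_norm (word_product A w)) <=
  K + n%:R * P + ln (mass mu (@word 'I_2 n) w).
Proof. by rewrite mass_word; have := example_upper w; rewrite size_tuple. Qed.

Let mu_lower n (w : n.-tuple 'I_2) : 0 < mass mu (@word 'I_2 n) w ->
  n%:R * P + ln (mass mu (@word 'I_2 n) w) <=
  K + s * ln (operator_norm (word_product A w)).
Proof. by rewrite mass_word; have := example_lower_mu w;
  rewrite size_tuple. Qed.

Let equilibriumP nu : equilibrium_state A s nu <->
  invariant_measure sh nu /\ free_energy A s nu = P%:E.
Proof.
apply: (equilibrium_stateP (nu0 := mu)) => //.
- by move=> nu' inv; exact: (free_energy_le_gibbs
    (@example_norm_ge1 R) s0 inv mu_gt0 mu_upper).
- exact: (free_energy_ge (@example_norm_ge1 R) s0 mu_invariant mu_lower).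
Qed.

Let mu_equilibrium : equilibrium_state A s mu.
Proof.
apply/equilibriumP; split=> //; apply/eqP; rewrite eq_le.
rewrite (free_energy_le_gibbs (@example_norm_ge1 R) s0 mu_invariant mu_gt0
  mu_upper)/=.
exact: (free_energy_ge (@example_norm_ge1 R) s0 mu_invariant mu_lower).
Qed.

Let mu_unique nu : equilibrium_state A s nu -> same_measure nu mu.
Proof.
move=> /equilibriumP[inv FP].
apply: (ergodic_abs_continuous mls mu_invariant inv mu_ergodic) => B mB.
exact: (abs_continuous_gibbs (@example_norm_ge1 R) s0 inv mu_gt0 mu_upper FP
  mB).
Qed.

Local Notation A2 := (@block_tuple R 3 'I_2 A 2).
Local Notation blocked nu := (distribution nu (@block 'I_2 2)).

Let size_blocks (W : seq (2.-tuple 'I_2)) :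
  size (flatten [seq val v | v <- W]) = (size W * 2)%N.
Proof. by elim: W => //= v W IH; rewrite size_cat size_tuple IH. Qed.

Let block_norm_ge1 W : 1 <= operator_norm (word_product A2 W).
Proof. by rewrite word_product_block_tuple example_norm_ge1. Qed.

Let block_gt0 n (W : n.-tuple (2.-tuple 'I_2)) :
  0 < mass (blocked mu) (@word (2.-tuple 'I_2) n) W.
Proof. by rewrite mass_word word_mass_distribution_block word_mass_mu_gt0. Qed.

(** A word of [n] blocks is a word of [2 n] letters, so the same constant [K] serves with [2 * P]
    for [P]. *)
Let block_upper n (W : n.-tuple (2.-tuple 'I_2)) :
  s * ln (operator_norm (word_product A2 W)) <=
  K + n%:R * (2 * P) + ln (mass (blocked mu) (@word (2.-tuple 'I_2) n) W).
Proof.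
rewrite mass_word word_mass_distribution_block word_product_block_tuple.
have := example_upper (flatten [seq val v | v <- W]).
by rewrite size_blocks size_tuple natrM -mulrA.
Qed.

Let block_energy nu : invariant_measure (iter 2 sh) nu ->
  (forall w, (size w)%:R * P + ln (word_mass nu w) <=
    K + s * ln (operator_norm (word_product A w))) ->
  invariant_measure (@left_shift _) (blocked nu) /\
  ((2 * P)%:E <= free_energy A2 s (blocked nu))%E.
Proof.
move=> inv lower; have inv2 := iffLR (invariant_distribution_block (n :=
  2) isT nu) inv.
split=> //; apply: (free_energy_ge (K := K) block_norm_ge1 s0 inv2) => n W _.
rewrite mass_word word_mass_distribution_block word_product_block_tuple.
have := lower (flatten [seq val v | v <- W]).
by rewrite size_blocks size_tuple natrM -mulrA.
Qed.

Let block_equilibriumP nu : equilibrium_state A2 s nu <->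
  invariant_measure (@left_shift _) nu /\ free_energy A2 s nu = (2 * P)%:E.
Proof.
have [inv ge] := block_energy nu1_invariant example_lower1.
apply: (equilibrium_stateP (nu0 := blocked nu1)) => //.
by move=> nu' inv'; exact: (free_energy_le_gibbs block_norm_ge1 s0 inv'
  block_gt0 block_upper).
Qed.

Let block_equilibrium nu : invariant_measure (iter 2 sh) nu ->
  (forall w, (size w)%:R * P + ln (word_mass nu w) <=
    K + s * ln (operator_norm (word_product A w))) ->
  block_equilibrium_state A 2 s nu.
Proof.
move=> inv lower; have [inv2 ge] := block_energy inv lower.
apply/block_equilibriumP; split=> //; apply/eqP; rewrite eq_le ge andbT.
exact: (free_energy_le_gibbs block_norm_ge1 s0 inv2 block_gt0 block_upper).
Qed.

(** The Gibbs bound makes [nu] absolutely continuous with respect to [mu]. If [nu] differed from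
    both measures, separation would give [nu]-null sets [D] and [D'] of full measure for [nu1] and
    [nu2]; the complement of their union is then [mu]-null, hence [nu]-null, which leaves [nu] no
    mass at all. *)
Let block_unique nu : block_equilibrium_state A 2 s nu ->
  ergodic (iter 2 sh) nu -> same_measure nu nu1 \/ same_measure nu nu2.
Proof.
move=> /block_equilibriumP[inv2 FP] erg.
have inv := iffRL (invariant_distribution_block (n := 2) isT nu) inv2.
have ac B : measurable B -> mu B = 0%E -> nu B = 0%E.
  move=> mB muB.
  have eB := preimage_block_unblock (n := 2) isT B.
  apply: etrans (congr1 nu (esym eB)) _.
  apply: (abs_continuous_gibbs block_norm_ge1 s0 inv2 block_gt0 block_upper FP
    (measurable_unblock_preimage (n := 2) mB)).
  exact: etrans (congr1 mu eB) muB.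
have m2 : measurable_fun setT (iter 2 sh) by exact: measurable_iter.
have [|dif1] := pselect (same_measure nu nu1); first by left.
have [|dif2] := pselect (same_measure nu nu2); first by right.
exfalso.
have [D [mD fD nuD n1D]] := ergodic_separation m2 inv nu1_invariant erg
  (nu1_ergodic (k := 0)) dif1.
have [D' [mD' fD' nuD' n2D']] := ergodic_separation m2 inv nu2_invariant erg
  (nu2_ergodic (k := 0)) dif2.
have mC := measurableU _ _ mD mD'.
have null (rho : probability (shift_space 'I_2) R) X : measurable X -> rho X
  = 1%E ->
    X `<=` D `|` D' -> rho (~` (D `|` D')) = 0%E.
  move=> mX rX XD; rewrite -probability_fineK; last exact: measurableC.
  rewrite fine_probabilityC//; congr (_%:E); apply/eqP; rewrite eq_le;
    apply/andP; split.
    have e1 : fine (rho X) = 1 by rewrite rX.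
    by rewrite subr_le0 -e1; exact: fine_probability_le.
  by rewrite subr_ge0 -lee_fin probability_fineK// probability_le1.
have muC : mu (~` (D `|` D')) = 0%E.
  rewrite muE (null nu1 D)// (null nu2 D')// ?adde0 ?mule0//.
have := ac _ (measurableC mC) muC.
rewrite -probability_fineK; last exact: measurableC.
rewrite fine_probabilityC// => -[nu1'].
have : (nu (D `|` D') <= nu D + nu D')%E by exact: measureU2.
rewrite nuD nuD' adde0 -probability_fineK// lee_fin.
by move: nu1'; lra.
Qed.

Lemma example_equilibrium_states :
  [/\ equilibrium_state A s mu,
      forall nu, equilibrium_state A s nu -> same_measure nu mu,
      ergodic (iter 3 sh) mu,
      ~ ergodic (iter 2 sh) mu &
      [/\ ~ same_measure nu1 nu2,
          block_equilibrium_state A 2 s nu1 /\ ergodic (iter 2 sh) nu1,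
          block_equilibrium_state A 2 s nu2 /\ ergodic (iter 2 sh) nu2 &
          forall nu, block_equilibrium_state A 2 s nu ->
            ergodic (iter 2 sh) nu ->
            same_measure nu nu1 \/ same_measure nu nu2]].
Proof.
split; [exact: mu_equilibrium|exact: mu_unique|exact: mu_ergodic3|
  exact: not_mu_ergodic2|split].
- exact: nu1_neq_nu2.
- split; last exact: (nu1_ergodic (k := 0)).
  exact: block_equilibrium nu1_invariant example_lower1.
- split; last exact: (nu2_ergodic (k := 0)).
  exact: block_equilibrium nu2_invariant example_lower2.
- exact: block_unique.
Qed.

End masses.

Lemma example_measures_exist :
  exists mu nu1 nu2 : probability (shift_space 'I_2) R,
  [/\ equilibrium_state A s mu,
      forall nu, equilibrium_state A s nu -> same_measure nu mu,
      ergodic (iter 3 sh) mu,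
      ~ ergodic (iter 2 sh) mu &
      [/\ ~ same_measure nu1 nu2,
          block_equilibrium_state A 2 s nu1 /\ ergodic (iter 2 sh) nu1,
          block_equilibrium_state A 2 s nu2 /\ ergodic (iter 2 sh) nu2,
          forall nu, block_equilibrium_state A 2 s nu ->
            ergodic (iter 2 sh) nu ->
            same_measure nu nu1 \/ same_measure nu nu2 &
          forall B, mu B = (2^-1%:E * (nu1 B + nu2 B))%E]].
Proof.
have q0 v : 0 < q v by exact: p0.
have [beta betaE] := bernoulli_measure_exists q0 sum_q.
have [nu1 nu1E] := pushforward_probability beta (@measurable_unblock 'I_2 2).
have [nu2 nu2E] := pushforward_probability nu1 mls.
have [mu muE] := average_probability nu1 nu2.
exists mu, nu1, nu2.
by have [? ? ? ? []] := example_equilibrium_states betaE nu1E nu2E muE.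
Qed.

End equilibrium_states.

Theorem proposition4 (R : realType) :
  irreducible_tuple (@example_pair R) /\
  forall s : R, 0 < s ->
  exists mu : probability (shift_space 'I_2) R,
    [/\ equilibrium_state (@example_pair R) s mu,
        forall nu : probability (shift_space 'I_2) R,
          equilibrium_state (@example_pair R) s nu -> same_measure nu mu,
        ergodic (iter 3 (@left_shift 'I_2)) mu,
        ~ ergodic (iter 2 (@left_shift 'I_2)) mu &
        exists nu1 nu2 : probability (shift_space 'I_2) R,
          [/\ ~ same_measure nu1 nu2,
              block_equilibrium_state (@example_pair R) 2 s nu1 /\
                ergodic (iter 2 (@left_shift 'I_2)) nu1,
              block_equilibrium_state (@example_pair R) 2 s nu2 /\
                ergodic (iter 2 (@left_shift 'I_2)) nu2,
              forall nu : probability (shift_space 'I_2) R,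
                block_equilibrium_state (@example_pair R) 2 s nu ->
                ergodic (iter 2 (@left_shift 'I_2)) nu ->
                same_measure nu nu1 \/ same_measure nu nu2 &
              forall B : set (shift_space 'I_2), measurable B ->
                mu B = (2^-1%:E * (nu1 B + nu2 B))%E]].
Proof.
split; first exact: example_irreducible.
move=> s s0; have [mu [nu1 [nu2 [eq uniq erg3 nerg2 [dif n1 n2 uniq2 avg]]]]] :=
  example_measures_exist s0.
by exists mu; split=> //; exists nu1, nu2; split.
Qed.
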